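(* Let $\Lambda$ be a finite set of sites and $N\ge2$. For each unordered pair $\langle xy\rangle$ of distinct sites let $J'_{xy},K'_{xy},J_{xy},K_{xy}\in\mathbb{R}$ satisfy $$\begin{cases}|J'_{xy}| & \text{if } |K'_{xy}|\le|J'_{xy}|\\ \tfrac14|K'_{xy}|\big(1+\tfrac{|J'_{xy}|}{|K'_{xy}|}\big)^2 & \text{if } |K'_{xy}|>|J'_{xy}|\end{cases}\ \le J_{xy}\qquad\text{and}\qquad \tfrac14|K'_{xy}|\le K_{xy}.$$ Let $\langle\cdot\rangle_{N,J',K'}$ be expectation in the $N$-component mixed isovector/isotensor model: spins $\sigma_x\in S^{N-1}\subset\mathbb{R}^N$, measure proportional to $\exp\{\sum_{\langle xy\rangle}[J'_{xy}\sigma_x\cdot\sigma_y+\tfrac12K'_{xy}(\sigma_x\cdot\sigma_y)^2]\}\prod_x d\Omega(\sigma_x)$, with $d\Omega$ uniform measure on $S^{N-1}$. Let $\langle\cdot\rangle_{XY,J,K}$ be expectation in the generalized $XY$ model: angles $\theta_x\in[0,2\pi)$, measure proportional to $\exp\{\sum_{\langle xy\rangle}[J_{xy}\cos(\theta_x-\theta_y)+K_{xy}\cos2(\theta_x-\theta_y)]\}\prod_x d\theta_x$. Then for all $x,y\in\Lambda$, $$|\langle\sigma_x\cdot\sigma_y\rangle_{N,J',K'}|\le\langle\cos(\theta_x-\theta_y)\rangle_{XY,J,K},$$ and, writing $\gamma_{xy}=\langle\cos2(\theta_x-\theta_y)\rangle_{XY,J,K}$, $$0\le\langle(\sigma_x\cdot\sigma_y)^2\rangle_{N,J',K'}\le\frac1N+\frac{(N-1)(N+2)}{N\,[2N-(N-2)\gamma_{xy}]}\gamma_{xy}\le\frac1N+\Big(1-\frac1N\Big)\gamma_{xy}.$$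 *)

(* Defs.v *)
From HB Require Import structures.
From mathcomp Require Import all_boot all_order all_algebra.
From mathcomp Require Import all_classical all_reals all_analysis.
Set Implicit Arguments. Unset Strict Implicit. Unset Printing Implicit Defensive.
Import Order.TTheory GRing.Theory Num.Theory.
Local Open Scope classical_set_scope.
Local Open Scope ring_scope.

Definition update (R : Type) (I : eqType) (v : I -> R) (i : I) (t : R) : I -> R :=
  fun j => if j == i then t else v j.

Fixpoint iterint (R : realType) (I : eqType) (D : set R) (s : seq I)
    (F : (I -> R) -> R) (v : I -> R) : R :=
  match s with
  | [::] => F v
  | i :: s' => Rintegral (@lebesgue_measure R) D
                 (fun t => iterint D s' F (update v i t))
  end.

Definition fint (R : realType) (I : finType) (D : set R) (F : (I -> R) -> R) : R :=
  iterint D (enum I) F (fun _ => 0).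

Definition pairsum (R : realType) (T : finType) (f : T -> T -> R) : R :=
  \sum_(x : T) \sum_(y : T | (enum_rank x < enum_rank y)%N) f x y.

(* Configurations u : T * 'I_N -> R (one vector u_x in R^N per site).
   The normalized uniform measure dOmega on S^{N-1} is realized as the cone
   measure: int g dOmega = (int_{|u|<=1} g(u/|u|) du) / vol(ball). *)
Definition spin (R : realType) (T : finType) (N : nat) (u : T * 'I_N -> R)
    (x : T) (i : 'I_N) : R :=
  u (x, i) / Num.sqrt (\sum_(j < N) u (x, j) ^+ 2).

Definition sdot (R : realType) (T : finType) (N : nat) (u : T * 'I_N -> R)
    (x y : T) : R :=
  \sum_(i < N) spin u x i * spin u y i.

Definition Nweight (R : realType) (T : finType) (N : nat) (J' K' : T -> T -> R)
    (u : T * 'I_N -> R) : R :=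
  expR (pairsum (fun x y => J' x y * sdot u x y + 2^-1 * K' x y * (sdot u x y) ^+ 2))
  * \prod_(x : T) (if \sum_(j < N) u (x, j) ^+ 2 <= 1 then 1 else 0).

Definition Nexp (R : realType) (T : finType) (N : nat) (J' K' : T -> T -> R)
    (g : (T * 'I_N -> R) -> R) : R :=
  fint setT (fun u => g u * Nweight J' K' u) / fint setT (@Nweight R T N J' K').

Definition XYweight (R : realType) (T : finType) (J K : T -> T -> R)
    (th : T -> R) : R :=
  expR (pairsum (fun x y => J x y * cos (th x - th y) + K x y * cos (2 * (th x - th y)))).

Definition XYexp (R : realType) (T : finType) (J K : T -> T -> R)
    (g : (T -> R) -> R) : R :=
  fint [set t : R | 0 <= t <= 2 * pi] (fun th => g th * XYweight J K th)
  / fint [set t : R | 0 <= t <= 2 * pi] (XYweight J K).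

(* Main.v *)
(** Fix a coordinate plane (i, j) and write the projection of each spin on it as
    r_x (cos phi_x, sin phi_x).  The single-spin measure is invariant under a
    rotation of every site x by its own angle theta_x in this plane, and, at a
    fixed configuration, the rotated weight is that of a generalized XY model
    in theta, with phases and with couplings J' a + K' a r and K' a^2 / 4, where
    a = r_x r_y and r is the scalar product of the components orthogonal to the
    plane, so that |r| <= 1 - a.  The hypotheses on J and K bound these couplings
    for all a in [0, 1], and Ginibre's inequality compares the two XY models.
    Summing over the planes gives the first bound; for the second moment, summing
    the bounds on the spin-2 correlations and using a rotation by pi / 4 to relate
    the fourth-order moments yields a linear inequality for E[(s_x . s_y)^2].

    The angles theta range over the grid (2 pi / m) Z with m odd, so that averages
    over rotations are finite sums and (p, q) |-> (p - q, p + q), which factorizes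
    cos A - cos (A' + al), is a bijection of the grid.  Only the comparison
    model depends on m, and m is sent to infinity at the very end. *)

(* The obstacle is that the rotated weight is not ferromagnetic: its couplings may be negative and
   its phases are arbitrary. Ginibre's duplication survives because only the second copy carries
   phases. Half of each phase goes to each rotated variable, so a product of gaps factorizes into
   one and the same function of the two variables, and its double sum is a square.

   The comparison at a fixed configuration is kept as an inequality between products, Z * sum <= C *
   sum, and not between ratios. The partition sum Z and the correlation sum C of the comparison
   model do not depend on the configuration, so the inequality can be integrated over all spins,
   whereas an average of ratios is not the ratio of the averages. *)
Require Import Defs.
From HB Require Import structures.
From mathcomp Require Import all_boot all_order all_algebra.
From mathcomp Require Import all_classical all_reals all_analysis measurable_realfun.
From mathcomp Require Import ring lra.
Import Order.TTheory GRing.Theory Num.Theory.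
Import numFieldNormedType.Exports.
Local Open Scope ring_scope.

(** * Iterated Lebesgue integrals *)

(* Measurability for the product sigma-algebra on I -> R, stated through
   composition so that this sigma-algebra need not be constructed. *)
Definition comeasurable {R : realType} {I : Type} (F : (I -> R) -> R) :=
  forall d (X : measurableType d) (v : X -> I -> R),
    (forall i, measurable_fun setT (fun x => v x i)) ->
    measurable_fun setT (fun x => F (v x)).

(* The support is bounded only in the directions of s: a coordinate that has been
   integrated out no longer constrains the support. *)
Definition tame {R : realType} {I : eqType} (s : seq I) (F : (I -> R) -> R) :=
  [/\ comeasurable F, exists M, forall v, `|F v| <= M
    & exists B, forall v i, i \in s -> B < `|v i| -> F v = 0].

Definition int1 {R : realType} {I : eqType} (i : I) (F : (I -> R) -> R)
    (v : I -> R) : R :=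
  Rintegral (@lebesgue_measure R) setT (fun t => F (update v i t)).

Section iterated_integrals.
Context {R : realType} {I : eqType}.
Implicit Types (F G : (I -> R) -> R) (v : I -> R) (s : seq I) (i j : I).
Local Open Scope classical_set_scope.
Local Open Scope ring_scope.
Local Notation mu := (@lebesgue_measure R).

Lemma updateE v i t j : update v i t j = if j == i then t else v j.
Proof. by []. Qed.

Lemma update_same v i t t' : update (update v i t) i t' = update v i t'.
Proof. by apply/funext => j; rewrite !updateE; case: eqP. Qed.

Lemma update_swap v i j t t' : i != j ->
  update (update v i t) j t' = update (update v j t') i t.
Proof.
move=> ij; apply/funext => k; rewrite !updateE.
by case: eqVneq => // ->; rewrite eq_sym (negbTE ij).
Qed.

Lemma measurable_update d (X : measurableType d) (v : X -> I -> R) i (t : X -> R) :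
  (forall i, measurable_fun setT (fun x => v x i)) -> measurable_fun setT t ->
  forall j, measurable_fun setT (fun x => update (v x) i (t x) j).
Proof. by move=> mv mt j; rewrite /update; case: eqP. Qed.

Lemma tame_sub s s' F : {subset s' <= s} -> tame s F -> tame s' F.
Proof. by move=> ss [mF bF [B sF]]; split=> //; exists B => v i /ss; exact: sF. Qed.

(** Domination by [M] times the indicator of [[-|B|, |B|]]; the absolute value spares a sign
    condition on [B]. *)
Lemma bounded_support_integrable (f : R -> R) (M B : R) :
  measurable_fun setT f -> (forall t, `|f t| <= M) ->
  (forall t, B < `|t| -> f t = 0) -> mu.-integrable setT (EFin \o f).
Proof.
move=> mf bf sf.
have := @integrable_indic_itv R (- `|B|) `|B| true false.
move=> /(integrableZl measurableT M) iM.
apply: (le_integrable measurableT _ _ iM); first exact/measurable_EFinP.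
move=> t _ /=; rewrite lee_fin indicE.
have M0 : 0 <= M by exact: le_trans (normr_ge0 (f 0)) (bf 0).
case: (boolP (t \in _)) => [_|]; first by rewrite mulr1 (ger0_norm M0).
rewrite notin_setE /= in_itv/= -ler_norml => /negP; rewrite -ltNge => h.
by rewrite sf ?normr0// (le_lt_trans _ h)// ler_norm.
Qed.

Lemma bounded_support_Rintegral_le (f : R -> R) (M B : R) :
  measurable_fun setT f -> (forall t, `|f t| <= M) ->
  (forall t, B < `|t| -> f t = 0) ->
  `|Rintegral mu setT f| <= M * (2 * `|B|).
Proof.
move=> mf bf sf.
have M0 : 0 <= M by exact: le_trans (normr_ge0 (f 0)) (bf 0).
have fi := bounded_support_integrable _ _ _ mf bf sf.
have gi := @integrable_indic_itv R (- `|B|) `|B| true false.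
apply: (le_trans (le_normr_Rintegral measurableT fi)).
set D := [set` _] in gi.
have gM : mu.-integrable setT (EFin \o (fun x => M * \1_D x)).
  by have := integrableZl measurableT M gi.
apply: (le_trans (le_Rintegral measurableT _ gM _)).
- exact: integrable_norm.
- move=> t _; rewrite indicE; case: (boolP (t \in _)) => [_|]; first by rewrite mulr1.
  rewrite notin_setE /D /= in_itv/= -ler_norml => /negP; rewrite -ltNge => h.
  by rewrite sf ?normr0 ?mulr0// (le_lt_trans _ h)// ler_norm.
rewrite RintegralZl//; apply: ler_wpM2l => //.
rewrite /Rintegral integral_indic//=; last by rewrite /D; exact: measurable_itv.
rewrite setIT lebesgue_measure_itv/=.
by case: ifP => _ /=; [rewrite opprK; lra | rewrite mulr_ge0].
Qed.

Lemma measurable_slice F v i : comeasurable F ->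
  measurable_fun setT (fun t => F (update v i t)).
Proof.
move=> mF; apply: (mF _ (measurableTypeR R) (fun t => update v i t)).
by apply: (@measurable_update _ (measurableTypeR R) (fun=> v) i id).
Qed.

Lemma tame_slice_integrable F i v s : i \in s -> tame s F ->
  mu.-integrable setT (EFin \o (fun t => F (update v i t))).
Proof.
move=> si [mF [M bF] [B sF]].
apply: (@bounded_support_integrable _ M B) => //; first exact: measurable_slice.
by move=> t Bt; apply: (sF _ i) => //; rewrite updateE eqxx.
Qed.

(** Tonelli's theorem is applied to the positive and negative parts separately, so that no
    integrability is required. *)
Lemma comeasurable_int1 F i : comeasurable F -> comeasurable (int1 i F).
Proof.
move=> mF d X v mv.
pose f (z : X * measurableTypeR R) : \bar R := (F (update (v z.1) i z.2))%:E.
have mf : measurable_fun setT f.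
  apply/measurable_EFinP.
  apply: (mF _ _ (fun z : X * measurableTypeR R => update (v z.1) i z.2)).
  apply: (@measurable_update _ _ (fun z : X * measurableTypeR R => v z.1) i snd).
    by move=> k; apply: (measurableT_comp (mv k) measurable_fst).
  exact: measurable_snd.
have mp := measurable_fun_fubini_tonelli_F (m2 := mu) _ (measurable_funepos mf) (fun=> funepos_ge0 _ _).
have mn := measurable_fun_fubini_tonelli_F (m2 := mu) _ (measurable_funeneg mf) (fun=> funeneg_ge0 _ _).
rewrite /int1 /Rintegral.
have : measurable_fun setT (fun x => (\int[mu]_y f (x, y))%E).
  rewrite (_ : (fun _ => _) = (fubini_F mu (f^\+) \- fubini_F mu (f^\-))%E); last first.
    apply/funext => x; rewrite [LHS]integralE.
    under eq_integral do rewrite funepos_comp/=.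
    by under [X in (_ - X)%E = _]eq_integral do rewrite funeneg_comp/=.
  exact: emeasurable_funB mp mn.
by move=> h; apply: (measurableT_comp _ h) => //.
Qed.

Lemma tame_int1 F i s : i \notin s -> tame (i :: s) F -> tame s (int1 i F).
Proof.
move=> si [mF [M bF] [B sF]]; split.
- exact: comeasurable_int1.
- exists (M * (2 * `|B|)) => v.
  apply: bounded_support_Rintegral_le => //; first exact: measurable_slice.
  by move=> t Bt; apply: (sF _ i); rewrite ?mem_head// updateE eqxx.
- exists B => v j sj Bj; rewrite /int1 /Rintegral.
  under eq_integral => t _.
    rewrite (sF _ j); first over.
      by rewrite inE sj orbT.
    by rewrite updateE; case: eqP => // ji; rewrite -ji sj in si.
  by rewrite integral0.
Qed.

Lemma iterint_cons i s F v :
  iterint setT (i :: s) F v = int1 i (iterint setT s F) v.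
Proof. by []. Qed.

Lemma iterint_cat s1 s2 F v :
  iterint setT (s1 ++ s2) F v = iterint setT s1 (iterint setT s2 F) v.
Proof.
elim: s1 v => [//|i s1 IH] v; rewrite cat_cons !iterint_cons /int1.
by congr Rintegral; apply/funext => t; rewrite IH.
Qed.

Lemma tame_iterint s s' F : uniq (s ++ s') -> tame (s ++ s') F ->
  tame s' (iterint setT s F).
Proof.
elim: s s' => [//|i s IH] s' u tF.
have -> : iterint setT (i :: s) F = int1 i (iterint setT s F) by [].
move: u; rewrite cat_cons cons_uniq mem_cat negb_or => /andP[/andP[is1 is2] u].
apply: tame_int1 => //; apply: IH.
  rewrite cat_uniq /= is2 negb_or is1 /=.
  by move: u; rewrite cat_uniq.
apply: tame_sub tF => j; rewrite !(inE, mem_cat).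
by case/or3P => ->; rewrite ?orbT.
Qed.

Lemma iterintD s F G v : uniq s -> tame s F -> tame s G ->
  iterint setT s (fun u => F u + G u) v = iterint setT s F v + iterint setT s G v.
Proof.
elim: s v => [//|i s IH] v u tF tG; have /andP[is1 us] := u.
have h (H : (I -> R) -> R) : tame (i :: s) H -> tame [:: i] (iterint setT s H).
  move=> tH; apply: tame_iterint; first by rewrite cats1 rcons_uniq.
  by apply: tame_sub tH => j; rewrite cats1 mem_rcons.
have w (H : (I -> R) -> R) : tame (i :: s) H -> tame s H by apply: tame_sub => j sj; rewrite inE sj orbT.
rewrite !iterint_cons /int1 -RintegralD //; last 2 first.
- exact: tame_slice_integrable (mem_head _ _) (h _ tF).
- exact: tame_slice_integrable (mem_head _ _) (h _ tG).
by congr Rintegral; apply/funext => t; rewrite IH//; apply: w.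
Qed.

Lemma iterintZ s F c v : uniq s -> tame s F ->
  iterint setT s (fun u => c * F u) v = c * iterint setT s F v.
Proof.
elim: s v => [//|i s IH] v u tF; have /andP[is1 us] := u.
have h : tame [:: i] (iterint setT s F).
  apply: tame_iterint; first by rewrite cats1 rcons_uniq.
  by apply: tame_sub tF => j; rewrite cats1 mem_rcons.
rewrite !iterint_cons /int1 -RintegralZl //; last first.
  exact: tame_slice_integrable (mem_head _ _) h.
congr Rintegral; apply/funext => t; rewrite IH//.
by apply: tame_sub tF => j sj; rewrite inE sj orbT.
Qed.

Lemma iterint_le s F G v : uniq s -> tame s F -> tame s G ->
  (forall u, F u <= G u) -> iterint setT s F v <= iterint setT s G v.
Proof.
move=> + + + FG; elim: s v => [//|i s IH] v u tF tG; have /andP[is1 us] := u.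
have h (H : (I -> R) -> R) : tame (i :: s) H -> tame [:: i] (iterint setT s H).
  move=> tH; apply: tame_iterint; first by rewrite cats1 rcons_uniq.
  by apply: tame_sub tH => j; rewrite cats1 mem_rcons.
have w (H : (I -> R) -> R) : tame (i :: s) H -> tame s H by apply: tame_sub => j sj; rewrite inE sj orbT.
rewrite !iterint_cons /int1; apply: le_Rintegral => //.
- exact: tame_slice_integrable (mem_head _ _) (h _ tF).
- exact: tame_slice_integrable (mem_head _ _) (h _ tG).
by move=> t _; apply: IH => //; apply: w.
Qed.

(** Fubini. The iterated integral of [|F|] is finite because the inner integral is at most
    [M * (2 * |B|)] and vanishes when the outer variable exceeds [|B|] in absolute value. *)
Lemma int1C i j F v : i != j -> tame [:: i; j] F ->
  int1 i (int1 j F) v = int1 j (int1 i F) v.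
Proof.
move=> ij tF; have [mF [M bF] [B sF]] := tF.
have tj : tame [:: j] F by apply: tame_sub tF => k; rewrite !inE => ->; rewrite orbT.
have ti : tame [:: i] F by apply: tame_sub tF => k; rewrite !inE => ->.
have M0 : 0 <= M by exact: le_trans (normr_ge0 _) (bF v).
pose f (z : measurableTypeR R * measurableTypeR R) : \bar R :=
  (F (update (update v i z.1) j z.2))%:E.
have mf : measurable_fun setT f.
  apply/measurable_EFinP.
  apply: (mF _ _ (fun z : measurableTypeR R * measurableTypeR R =>
    update (update v i z.1) j z.2)).
  apply: (@measurable_update _ _ (fun z : measurableTypeR R * measurableTypeR R =>
     update v i z.1) j snd); last exact: measurable_snd.
  apply: (@measurable_update _ _ (fun=> v) i fst); last exact: measurable_fst.
  by move=> k; exact: measurable_cst.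
have fi : (mu \x mu)%E.-integrable setT f.
  apply: (proj2 (integrable12ltyP mu mu mf)).
  have gi := integrableZl measurableT (M * (2 * `|B|)) (@integrable_indic_itv R (- `|B|) `|B| true false).
  set g := (X in _.-integrable _ X) in gi.
  apply: (@le_lt_trans _ _ (\int[mu]_x `|g x|)%E); last by case/integrableP: gi.
  have mg : measurable_fun setT (fun y : measurableTypeR R => `|g y|)%E.
    by apply: measurableT_comp => //; case/integrableP: gi.
  apply: ge0_le_integral => //=.
  - by move=> x _; apply: integral_ge0.
  - apply: (measurable_fun_fubini_tonelli_F (m2 := mu) (abse \o f)) => //=.
    exact: measurableT_comp.
  move=> x _; rewrite /g /f /=.
  pose k y := F (update (update v i x) j y).
  have ki : mu.-integrable setT (EFin \o k) by exact: tame_slice_integrable (mem_head _ _) tj.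
  have kn := integrable_norm ki.
  have -> : (\int[mu]_y `|k y|%:E)%E = (Rintegral mu setT (Num.norm \o k))%:E.
    by rewrite /Rintegral fineK//; exact: integrable_fin_num.
  rewrite lee_fin indicE.
  case: (boolP (x \in _)) => [_|].
    rewrite mulr1 ger0_norm; last by rewrite !mulr_ge0.
    apply: (le_trans (ler_norm _)); apply: bounded_support_Rintegral_le.
    - by apply: measurableT_comp => //; exact: measurable_slice.
    - by move=> t /=; rewrite normr_id; exact: bF.
    - move=> t Bt /=; rewrite /k (sF _ j) ?normr0// ?updateE ?eqxx//.
      by rewrite !inE eqxx orbT.
  rewrite notin_setE /= in_itv/= -ler_norml => /negP; rewrite -ltNge => h.
  have -> : Num.norm \o k = cst 0.
    apply/funext => y /=; rewrite /k (sF _ i) ?normr0// ?mem_head//.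
    by rewrite !updateE (negbTE ij) eqxx (le_lt_trans _ h)// ler_norm.
  by rewrite Rintegral_cst// mul0r.
have := Fubini fi; rewrite /f /= => E.
have e1 : (\int[mu]_x \int[mu]_y (F (update (update v i x) j y))%:E)%E
    = (\int[mu]_x (int1 j F (update v i x))%:E)%E.
  apply: eq_integral => x _; rewrite /int1 /Rintegral fineK//.
  by apply: integrable_fin_num => //; exact: tame_slice_integrable (mem_head _ _) tj.
have e2 : (\int[mu]_y \int[mu]_x (F (update (update v i x) j y))%:E)%E
    = (\int[mu]_y (int1 i F (update v j y))%:E)%E.
  apply: eq_integral => y _; rewrite /int1 /Rintegral fineK//; last first.
    by apply: integrable_fin_num => //; exact: tame_slice_integrable (mem_head _ _) ti.
  by apply: eq_integral => x _; rewrite update_swap.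
by rewrite {1}/int1 /Rintegral -e1 E e2.
Qed.

Lemma iterint_cons_rcons i s F v : uniq (i :: s) -> tame (i :: s) F ->
  iterint setT (i :: s) F v = iterint setT (rcons s i) F v.
Proof.
elim: s v => [//|j s IH] v.
rewrite !cons_uniq inE negb_or -andbA => /and4P[ij is1 js us] tF.
transitivity (int1 j (iterint setT (i :: s) F) v).
  apply: int1C => //; apply: tame_iterint.
    rewrite cat_uniq us /= !inE (negbTE ij) !orbF negb_or is1 js //.
  apply: tame_sub tF => k; rewrite !(inE, mem_cat).
  by case/or3P => ->; rewrite ?orbT.
rewrite rcons_cons /= /int1; congr Rintegral; apply/funext => t; apply: IH.
  by rewrite /= is1.
by apply: tame_sub tF => k; rewrite !inE => /orP[]->; rewrite ?orbT.
Qed.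

(** Brings the variable [i] to the innermost integral, where all other coordinates are frozen and
    one-dimensional translation invariance applies. *)
Lemma iterint_to_last i s1 s2 F v : uniq (s1 ++ i :: s2) -> tame (s1 ++ i :: s2) F ->
  iterint setT (s1 ++ i :: s2) F v = iterint setT (rcons (s1 ++ s2) i) F v.
Proof.
move=> u tF; rewrite rcons_cat !iterint_cat; congr iterint; apply/funext => w.
apply: iterint_cons_rcons; first by move: u; rewrite cat_uniq => /and3P[].
by apply: tame_sub tF => k ks; rewrite mem_cat ks orbT.
Qed.

End iterated_integrals.

(** * Rotation invariance *)

Definition rot2 {R : realType} {I : eqType} (i j : I) (c s : R) (v : I -> R) : I -> R :=
  update (update v i (c * v i - s * v j)) j (s * v i + c * v j).

Definition siterot {R : realType} {T : eqType} {N : nat} (i j : 'I_N) (c s : T -> R)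
    (u : T * 'I_N -> R) : T * 'I_N -> R :=
  fun z => if z.2 == i then c z.1 * u (z.1, i) - s z.1 * u (z.1, j)
           else if z.2 == j then s z.1 * u (z.1, i) + c z.1 * u (z.1, j) else u z.

Section rotations.
Context {R : realType}.
Local Open Scope classical_set_scope.
Local Open Scope ring_scope.
Local Notation mu := (@lebesgue_measure R).

(** By uniqueness of the Lebesgue measure it suffices to compare the two measures on half-open
    intervals. *)
Lemma lebesgue_measure_shift (h : R) (A : set (measurableTypeR R)) : measurable A ->
  pushforward mu (fun t : measurableTypeR R => t + h : measurableTypeR R) A = mu A.
Proof.
have mh : measurable_fun setT (fun t : measurableTypeR R => t + h : measurableTypeR R).
  by apply: measurable_funD.
move=> mA; apply/esym/lebesgue_measure_unique => //= _ [[a b]] _ <-.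
rewrite /pushforward.
have -> : (fun t : R => t + h) @^-1` `]a, b] = `]a - h, b - h]%classic.
  by apply/seteqP; split => t /=; rewrite !in_itv/= ltrBlDr lerBrDr.
rewrite !lebesgue_measure_itv/= !lte_fin ltrD2r.
by case: ifP => // _; rewrite -!EFinB; congr EFin; ring.
Qed.

Lemma Rintegral_shift (f : R -> R) h :
  measurable_fun setT f -> mu.-integrable setT (EFin \o (fun t => f (t + h))) ->
  Rintegral mu setT (fun t => f (t + h)) = Rintegral mu setT f.
Proof.
move=> mf fi; rewrite /Rintegral; congr fine.
pose phi (t : measurableTypeR R) : measurableTypeR R := t + h.
have mh : measurable_fun setT phi by apply: measurable_funD.
transitivity (\int[pushforward mu phi]_y (f y)%:E)%E.
  rewrite (@integral_pushforward _ _ _ _ R phi mh mu setT (EFin \o f)) //.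
  exact/measurable_EFinP.
by apply: eq_measure_integral => A mA _; apply: lebesgue_measure_shift.
Qed.

Context {I : eqType}.
Implicit Types (F : (I -> R) -> R) (v : I -> R).

Lemma comeasurable_comp F (phi : (I -> R) -> I -> R) : comeasurable F ->
  (forall i, comeasurable (fun v => phi v i)) -> comeasurable (fun v => F (phi v)).
Proof. by move=> mF mphi d X v mv; apply: mF => i; apply: mphi. Qed.

(** Since [h] ignores coordinate [i], it is a constant once [i] is innermost, and the substitution
    is a translation of the line. *)
Lemma iterint_shift i s F h v : uniq s -> i \in s -> tame s F ->
  (forall v t, h (update v i t) = h v) ->
  tame s (fun v => F (update v i (v i + h v))) ->
  iterint setT s (fun v => F (update v i (v i + h v))) v = iterint setT s F v.
Proof.
move=> us si tF hi tG; case/splitPr: si us tF tG => s1 s2 us tF tG.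
rewrite !iterint_to_last // -cats1 !iterint_cat; congr iterint; apply/funext => w0.
congr iterint; apply/funext => w.
have ie : i \in s1 ++ i :: s2 by rewrite mem_cat mem_head orbT.
have E : (fun t => F (update (update w i t) i (update w i t i + h (update w i t))))
    = (fun t => F (update w i (t + h w))).
  by apply/funext => t; rewrite updateE eqxx hi update_same.
have := tame_slice_integrable _ i w _ ie tG; rewrite E => fi.
change (Rintegral mu setT (fun t => F (update (update w i t) i (update w i t i + h (update w i t)))) = Rintegral mu setT (fun t => F (update w i t))).
rewrite E.
apply: (Rintegral_shift (fun t => F (update w i t))) => //.
by case: tF => mF _ _; apply: measurable_slice.
Qed.

Definition shear (i j : I) (c : R) v := update v i (v i + c * v j).

Lemma tame_shear i j c s F : i != j -> j \in s -> tame s F ->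
  tame s (fun v => F (shear i j c v)).
Proof.
move=> ij js [mF [M bF] [B sF]]; split.
- apply: comeasurable_comp => // k d X v mv; rewrite /shear.
  apply: measurable_update => //; apply: measurable_funD => //.
  exact: measurable_funM.
- by exists M => v.
(* If [|v i|] exceeds this bound, then either [|v j| > |B|] or [|v i + c * v j| > |B|], and [F]
   vanishes in both cases. *)
exists (`|B| * (1 + `|c|)) => v k ks Bk.
have BB : B <= `|B| by exact: ler_norm.
have B1 : `|B| <= `|B| * (1 + `|c|) by rewrite ler_peMr ?normr_ge0// lerDl.
have [ki|ki] := eqVneq k i; last first.
  apply: (sF _ k) => //; rewrite /shear updateE (negbTE ki).
  by apply: le_lt_trans Bk; exact: le_trans B1.
have [vj|vj] := ltP `|B| `|v j|.
  apply: (sF _ j) => //; rewrite /shear updateE eq_sym (negbTE ij).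
  exact: le_lt_trans vj.
apply: (sF _ k) => //; rewrite /shear updateE ki eqxx.
apply: (le_lt_trans BB); rewrite ki in Bk.
have := lerB_normD (v i) (c * v j); rewrite normrM => h.
have : `|c| * `|v j| <= `|c| * `|B| by exact: ler_wpM2l.
lra.
Qed.

Lemma iterint_shear i j c s F v : uniq s -> i != j -> i \in s -> j \in s ->
  tame s F -> iterint setT s (fun v => F (shear i j c v)) v = iterint setT s F v.
Proof.
move=> us ij is_ js tF; apply: (iterint_shift i s F (fun v => c * v j)) => //.
- by move=> w t; rewrite updateE eq_sym (negbTE ij).
- exact: tame_shear.
Qed.

(* A plane rotation is a product of three shears, each of them a translation in
   one coordinate: translation invariance of the Lebesgue measure suffices. *)
Lemma rot2_shear i j c s v : i != j -> c ^+ 2 + s ^+ 2 = 1 -> c != -1 ->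
  rot2 i j c s v =
  shear i j (- s / (1 + c)) (shear j i s (shear i j (- s / (1 + c)) v)).
Proof.
move=> ij cs c1.
have c1' : 1 + c != 0 by apply: contra c1 => /eqP h; apply/eqP; lra.
have s2 : s ^+ 2 = (1 - c) * (1 + c) by lra.
set a := - s / (1 + c).
have sa : s * a = c - 1 by rewrite /a mulrA mulrN -expr2 s2 mulNr mulfK//; ring.
have aa : a * (1 + c) = - s by rewrite /a mulfVK.
have ji : j != i by rewrite eq_sym.
apply/funext => k; rewrite /rot2 /shear !updateE.
case: (eqVneq k j) => [->|kj]; last case: (eqVneq k i) => [_|//].
- rewrite (negbTE ji) eqxx mulrDr mulrA sa; ring.
- rewrite (negbTE ji) (negbTE ij) !eqxx.
  rewrite (_ : c * v i - s * v j = (1 + s * a) * v i + a * (1 + c) * v j); last first.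
    by rewrite sa aa; ring.
  have -> : 1 + c = 2 + s * a by rewrite sa; ring.
  by ring.
Qed.

Lemma tame_rot2 i j c s l F : i != j -> i \in l -> j \in l ->
  c ^+ 2 + s ^+ 2 = 1 -> uniq l -> tame l F ->
  tame l (fun v => F (rot2 i j c s v)) /\
  forall v, iterint setT l (fun v => F (rot2 i j c s v)) v = iterint setT l F v.
Proof.
move=> ij il jl; have ji : j != i by rewrite eq_sym.
have main a b G : a ^+ 2 + b ^+ 2 = 1 -> a != -1 -> uniq l -> tame l G ->
    tame l (fun v => G (rot2 i j a b v)) /\
    forall v, iterint setT l (fun v => G (rot2 i j a b v)) v = iterint setT l G v.
  move=> ab a1 ul tG.
  have -> : (fun v => G (rot2 i j a b v)) = (fun v => G (shear i j (- b / (1 + a))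
      (shear j i b (shear i j (- b / (1 + a)) v)))).
    by apply/funext => v; rewrite rot2_shear.
  have t1 := tame_shear i j (- b / (1 + a)) l G ij jl tG.
  have t2 := tame_shear j i b l _ ji il t1.
  have t3 := tame_shear i j (- b / (1 + a)) l _ ij jl t2.
  split=> // v.
  by rewrite (iterint_shear i j _ l _ v ul ij il jl t2)
    (iterint_shear j i _ l _ v ul ji jl il t1) (iterint_shear i j _ l _ v ul ij il jl tG).
move=> cs ul tF; have [c1|c1] := eqVneq c (-1); last exact: main.
have s0 : s = 0 by apply/eqP; rewrite -sqrf_eq0; apply/eqP; rewrite c1 in cs; lra.
(* The half turn, for which the shear coefficient is undefined, is the square of the quarter
   turn. *)
have -> : (fun v => F (rot2 i j c s v)) = (fun v => F (rot2 i j 0 1 (rot2 i j 0 1 v))).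
  apply/funext => v; congr F; apply/funext => k; rewrite /rot2 !updateE c1 s0.
  rewrite !eqxx (negbTE ij).
  case: (eqVneq k j) => [_|kj].
    by ring.
  by case: eqVneq => // _; ring.
have n1 : (0 : R) != -1 by rewrite eq_sym oppr_eq0 oner_eq0.
have e1 : (0 : R) ^+ 2 + 1 ^+ 2 = 1 by rewrite expr0n expr1n add0r.
have [t1 h1] := main _ _ _ e1 n1 ul tF.
have [t2 h2] := main _ _ _ e1 n1 ul t1.
by split=> // v; rewrite h2 h1.
Qed.


End rotations.

Lemma tame_siterot {R : realType} {T : finType} {N : nat} (i j : 'I_N) (c s : T -> R)
    (F : (T * 'I_N -> R) -> R) : i != j -> (forall x, c x ^+ 2 + s x ^+ 2 = 1) ->
  tame (enum {: T * 'I_N}) F ->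
  tame (enum {: T * 'I_N}) (fun u => F (siterot i j c s u)) /\
  fint setT (fun u => F (siterot i j c s u)) = fint setT F.
Proof.
move=> ij cs tF; rewrite /fint; set l := enum _ in tF *.
(* Sites are rotated one at a time: [cl a] and [sl a] rotate the sites of [a] and fix the others. *)
pose cl (a : seq T) x := if x \in a then c x else 1.
pose sl (a : seq T) x := if x \in a then s x else 0.
have ul : uniq l by exact: enum_uniq.
suff H a : uniq a -> tame l (fun u => F (siterot i j (cl a) (sl a) u)) /\
    forall w : T * 'I_N -> R,
      iterint setT l (fun u => F (siterot i j (cl a) (sl a) u)) w = iterint setT l F w.
  have ce : cl (enum T) = c by apply/funext => x; rewrite /cl mem_enum.
  have se : sl (enum T) = s by apply/funext => x; rewrite /sl mem_enum.
  by have [] := H _ (enum_uniq T); rewrite ce se => t h; split.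
elim: a => [_|x a IH /= /andP[xa ua]].
  rewrite (_ : (fun u => F (siterot i j (cl [::]) (sl [::]) u)) = F) //.
  apply/funext => u; congr F; apply/funext => -[x k]; rewrite /siterot /cl /sl /=.
  by case: (eqVneq k i) => [->|_]; [|case: (eqVneq k j) => [->|//]]; ring.
have [t1 h1] := IH ua.
have ijx : ((x, i) : T * 'I_N) != (x, j) by rewrite xpair_eqE eqxx.
have [t2 h2] := tame_rot2 (x, i) (x, j) (c x) (s x) l _ ijx
  (mem_enum _ _) (mem_enum _ _) (cs x) ul t1.
rewrite (_ : (fun u => F (siterot i j (cl (x :: a)) (sl (x :: a)) u)) =
  (fun u => F (siterot i j (cl a) (sl a) (rot2 (x, i) (x, j) (c x) (s x) u)))).
  by split=> // w; rewrite h2 h1.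
apply/funext => u; congr F; apply/funext => -[y k].
rewrite /siterot /rot2 !updateE /cl /sl /= !inE !xpair_eqE.
have ji : j != i by rewrite eq_sym.
case: (eqVneq y x) => [->|yx] /=; last by [].
rewrite (negbTE xa) !eqxx (negbTE ij) ?(negbTE ji).
case: (eqVneq k i) => [_|ki]; first by rewrite ?(negbTE ij) ?(negbTE ji); ring.
by case: (eqVneq k j) => [_|//]; ring.
Qed.

(** * The Ginibre inequality on a finite torus *)

Section ginibre.
Context {R : realType} {T : finType} {n : nat}.
Local Notation G := {ffun T -> 'I_n.+1}.

(** A character of the group [G], given by a real lift of its argument. The lift is additive only
    modulo 2 pi, hence the two conditions on cosine and sine. *)
Record angle := Angle {
  angle_fun :> G -> R;
  cos_angleD : forall g h, cos (angle_fun (g + h)) = cos (angle_fun g + angle_fun h);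
  sin_angleD : forall g h, sin (angle_fun (g + h)) = sin (angle_fun g + angle_fun h) }.

Lemma cos_angleB (A : angle) g h : cos (A (g - h)) = cos (A g - A h).
Proof.
have c := cos_angleD A (g - h) h; have s := sin_angleD A (g - h) h.
rewrite subrK in c s; rewrite cosB c s -cosB.
by congr cos; rewrite addrK.
Qed.

Definition gap (a : angle * R) (z : G * G) : R := cos (a.1 z.1) - cos (a.1 z.2 + a.2).

Definition rotate_pair (z : G * G) : G * G := (z.1 - z.2, z.1 + z.2).

(** The identity cos (X - Y) - cos (X + Y) = 2 sin X sin Y, with half of the phase in each of X and
    Y; the phase cancels in X - Y. Both factors are then the same function, taken at [p] and at
    [q]. *)
Lemma gap_rotated a p q :
  gap a (rotate_pair (p, q)) = 2 * sin (a.1 p + a.2 / 2) * sin (a.1 q + a.2 / 2).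
Proof.
case: a => A t; rewrite /gap /rotate_pair /= cos_angleB [cos (A (p + q) + t)]cosD cos_angleD sin_angleD -cosD.
have -> : A p - A q = (A p + t / 2) - (A q + t / 2) by ring.
have -> : A p + A q + t = (A p + t / 2) + (A q + t / 2) by field.
by set X := A p + t / 2; set Y := A q + t / 2; rewrite cosB cosD; ring.
Qed.

Context (n_even : ~~ odd n).

(** The modulus [n.+1] is odd, so 2 is invertible: its inverse is [n./2.+1], because twice that
    number is [n + 2]. *)
Lemma sum_rotated (H : G * G -> R) :
  \sum_z H z = \sum_z H (rotate_pair z).
Proof.
have h (x : G) : (x + x) *+ n./2.+1 = x.
  rewrite -mulr2n -mulrnA mul2n doubleS halfK (negbTE n_even) subn0 mulrS.
  suff -> : x *+ n.+1 = 0 by rewrite addr0.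
  apply/ffunP => t; rewrite ffunMnE ffunE; apply/val_inj => /=.
  by rewrite Zp_mulrn /= modnMl.
apply: reindex; exists (fun z => ((z.1 + z.2) *+ n./2.+1, (z.2 - z.1) *+ n./2.+1)).
  move=> [p q] _ /=; congr pair; rewrite -[RHS]h; congr (_ *+ _).
    by rewrite addrACA addNr addr0.
  by rewrite opprB addrC addrA subrK.
move=> [p q] _ /=; rewrite /rotate_pair /= -mulrnBl -mulrnDl; congr pair; rewrite -[RHS]h; congr (_ *+ _).
  by rewrite opprB addrC addrACA addNr addr0.
by rewrite addrC addrA subrK.
Qed.

(** All products of gaps are tested at once, so that one more gap factor can be absorbed into the
    list. *)
Definition gap_pos (h : G * G -> R) :=
  forall l : seq (angle * R), 0 <= \sum_z h z * \prod_(a <- l) gap a z.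

(* Unlike gap_pos, this class is closed under powers, hence under exp. *)
Definition gap_mult (f : G * G -> R) :=
  forall h, gap_pos h -> gap_pos (fun z => f z * h z).

(* In the rotated variables the sum is the square of a sum over one variable. *)
Lemma gap_pos1 : gap_pos (fun=> 1).
Proof.
move=> l; rewrite sum_rotated.
pose F p : R := \prod_(a <- l) sin (a.1 p + a.2 / 2).
have -> : \sum_z 1 * \prod_(a <- l) gap a (rotate_pair z)
    = 2 ^+ size l * (\sum_p F p) ^+ 2.
  transitivity (\sum_(z : G * G) 2 ^+ size l * (F z.1 * F z.2)).
    apply: eq_bigr => -[p q] _ /=; rewrite mul1r.
    under eq_bigr do rewrite gap_rotated.
    rewrite !big_split /= /F -mulrA; congr (_ * _).
    by rewrite big_const_seq count_predT iter_mulr_1.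
  rewrite -mulr_sumr -(pair_bigA _ (fun p q => F p * F q)) /=; congr (_ * _).
  by rewrite expr2 mulr_suml; apply: eq_bigr => p _; rewrite mulr_sumr.
by apply: mulr_ge0; [exact: exprn_ge0|exact: sqr_ge0].
Qed.

Lemma gap_mult_gap a : gap_mult (gap a).
Proof.
move=> h ph l; have := ph (a :: l); congr (_ <= _).
by apply: eq_bigr => z _; rewrite big_cons; ring.
Qed.

Lemma gap_multD f g : gap_mult f -> gap_mult g -> gap_mult (fun z => f z + g z).
Proof.
move=> mf mg h ph l; under eq_bigr do rewrite !mulrDl.
by rewrite big_split /= addr_ge0 ?mf ?mg.
Qed.

Lemma gap_multZ c f : 0 <= c -> gap_mult f -> gap_mult (fun z => c * f z).
Proof.
move=> c0 mf h ph l; under eq_bigr do rewrite -!(mulrA c).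
by rewrite -mulr_sumr mulr_ge0// mf.
Qed.

Lemma gap_multX f k : gap_mult f -> gap_mult (fun z => f z ^+ k).
Proof.
move=> mf; elim: k => [|k IH] h ph l.
  by under eq_bigr do rewrite expr0 mul1r; exact: ph.
by under eq_bigr do rewrite exprS -(mulrA (f _)); apply: mf; exact: IH.
Qed.

Lemma gap_mult_sum (I : Type) (r : seq I) (P : pred I) (f : I -> G * G -> R) :
  (forall i, P i -> gap_mult (f i)) -> gap_mult (fun z => \sum_(i <- r | P i) f i z).
Proof.
move=> mf; elim: r => [|i r IH].
  by move=> h ph l; under eq_bigr do rewrite big_nil !mul0r; rewrite big1_eq.
case Pi : (P i); last by under eq_fun do rewrite big_cons Pi.
by under eq_fun do rewrite big_cons Pi; apply: gap_multD => //; exact: mf.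
Qed.

(** The partial sums of the exponential series are nonnegative combinations of powers of [f], and
    the inequality is preserved in the limit since the sum over [z] is finite. *)
Lemma gap_mult_exp f : gap_mult f -> gap_mult (fun z => expR (f z)).
Proof.
move=> mf h ph l.
have c : (\sum_z series (exp_coeff (f z)) k * h z * \prod_(a <- l) gap a z
   @[k --> \oo] --> \sum_z expR (f z) * h z * \prod_(a <- l) gap a z)%classic.
  apply: cvg_big; first exact: add_continuous.
  move=> z _;   do 2 apply: cvgMr_tmp.
  exact: is_cvg_series_exp_coeff.
rewrite -(cvg_lim _ c)//; apply: limr_ge; first by apply/cvg_ex; eexists; exact: c.
apply: nearW => k.
have : gap_mult (fun z => series (exp_coeff (f z)) k).
  apply: gap_mult_sum => i _.
  have -> : (fun z => exp_coeff (f z) i) = (fun z => i`!%:R^-1 * f z ^+ i).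
    by apply/funext => z; rewrite exp_coeffE.
  by apply: gap_multZ; [rewrite invr_ge0|exact: gap_multX].
by move=> /(_ h ph l).
Qed.

(* J cos A + J' cos (A' + al) is a positive combination of the two gaps with
   phases al and al + pi. *)
Lemma gap_mult_cos (A : angle) (al J J' : R) : `|J'| <= J ->
  gap_mult (fun z => J * cos (A z.1) + J' * cos (A z.2 + al)).
Proof.
rewrite ler_norml => /andP[h1 h2].
have -> : (fun z => J * cos (A z.1) + J' * cos (A z.2 + al)) =
  (fun z => (J - J') / 2 * gap (A, al) z + (J + J') / 2 * gap (A, al + pi) z).
  apply/funext => z; rewrite /gap /= addrA cosDpi; by field.
by apply: gap_multD; apply: gap_multZ; rewrite ?divr_ge0//; try lra; exact: gap_mult_gap.
Qed.

(** The difference of the two sides is the double sum of one gap against the duplicated weight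
    [expR (E z.1 + E' z.2)], which is nonnegative by positivity of the constant 1. *)
Lemma ginibre (E E' : G -> R) (A : angle) (al : R) :
  gap_mult (fun z => E z.1 + E' z.2) ->
  (\sum_g expR (E g)) * (\sum_g cos (A g + al) * expR (E' g)) <=
  (\sum_g cos (A g) * expR (E g)) * (\sum_g expR (E' g)).
Proof.
move=> /gap_mult_exp m; rewrite -subr_ge0.
have := gap_mult_gap (A, al) _ (m _ gap_pos1) [::]; congr (_ <= _).
rewrite !mulr_suml -sumrB (eq_bigr (fun z : G * G =>
  cos (A z.1) * expR (E z.1) * expR (E' z.2) -
   expR (E z.1) * (cos (A z.2 + al) * expR (E' z.2)))); last first.
  by move=> z _; rewrite big_nil /gap /= expRD; ring.
rewrite -(pair_bigA _ (fun p q => cos (A p) * expR (E p) * expR (E' q) -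
   expR (E p) * (cos (A q + al) * expR (E' q)))) /=.
by apply: eq_bigr => p _; rewrite sumrB !mulr_sumr.
Qed.

End ginibre.

(** * Clock angles *)

Section clock.
Context {R : realType} {T : finType} {n : nat}.
Local Notation G := {ffun T -> 'I_n.+1}.
Implicit Types (g h : G) (x y : T).

Definition clock_angle g x : R := 2 * pi / n.+1%:R * (g x)%:R.

(** Addition in ['I_n.+1] wraps around, and every wrap is a full turn; [k] counts them. *)
Lemma clock_angleD g h x : exists k : nat,
  clock_angle g x + clock_angle h x = clock_angle (g + h) x + (pi *+ 2) *+ k.
Proof.
exists ((g x + h x) %/ n.+1)%N; rewrite /clock_angle ffunE /=.
rewrite -mulrDr -natrD {1}(divn_eq (g x + h x) n.+1) natrD natrM.
by rewrite -[(pi *+ 2) *+ _]mulr_natr -[pi *+ 2]mulr_natr; field.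
Qed.

Lemma cos_site_angleD x g h :
  cos (clock_angle (g + h) x) = cos (clock_angle g x + clock_angle h x).
Proof. by have [k ->] := clock_angleD g h x; rewrite (periodicn (@cosD2pi R)). Qed.

Lemma sin_site_angleD x g h :
  sin (clock_angle (g + h) x) = sin (clock_angle g x + clock_angle h x).
Proof. by have [k ->] := clock_angleD g h x; rewrite (periodicn (@sinD2pi R)). Qed.

Definition site_angle x : angle :=
  Angle (fun g => clock_angle g x) (cos_site_angleD x) (sin_site_angleD x).

Lemma cos_diff_angleD (A B : @angle R T n) g h :
  cos (A (g + h) - B (g + h)) = cos (A g - B g + (A h - B h)).
Proof.
rewrite cosB !cos_angleD !sin_angleD -cosB; congr cos; ring.
Qed.

Lemma sin_diff_angleD (A B : @angle R T n) g h :
  sin (A (g + h) - B (g + h)) = sin (A g - B g + (A h - B h)).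
Proof.
rewrite sinB !cos_angleD !sin_angleD -sinB; congr sin; ring.
Qed.

Definition diff_angle (A B : @angle R T n) : angle :=
  Angle (fun g => A g - B g) (cos_diff_angleD A B) (sin_diff_angleD A B).

Lemma cos_double_angleD (A : @angle R T n) g h :
  cos (2 * A (g + h)) = cos (2 * A g + 2 * A h).
Proof.
rewrite -mulrDr !mulr_natl !cos_mulr2n cos_angleD //.
Qed.

Lemma sin_double_angleD (A : @angle R T n) g h :
  sin (2 * A (g + h)) = sin (2 * A g + 2 * A h).
Proof.
by rewrite -mulrDr !mulr_natl !sin_mulr2n cos_angleD sin_angleD.
Qed.

Definition double_angle (A : @angle R T n) : angle :=
  Angle (fun g => 2 * A g) (cos_double_angleD A) (sin_double_angleD A).

Definition zero_phase (x y : T) : R := 0.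

(** The same formula serves the comparison model, with [zero_phase], and the rotated spin model,
    with phases [phi x - phi y]. The second harmonic sees the doubled phase. *)
Definition clock_energy (J K al : T -> T -> R) g : R :=
  pairsum (fun x y => J x y * cos (clock_angle g x - clock_angle g y + al x y) +
     K x y * cos (2 * (clock_angle g x - clock_angle g y + al x y))).

(** Each pair of sites contributes two terms of the form treated by [gap_mult_cos]: one for the
    angle difference and one for its double, with phase [2 * al x y]. *)
Lemma clock_gap_mult (J K J' K' al : T -> T -> R) :
  (forall x y, x != y -> `|J' x y| <= J x y) ->
  (forall x y, x != y -> `|K' x y| <= K x y) ->
  gap_mult (fun z : G * G => clock_energy J K zero_phase z.1 + clock_energy J' K' al z.2).
Proof.
move=> hJ hK.
have -> : (fun z : G * G => clock_energy J K zero_phase z.1 + clock_energy J' K' al z.2) =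
  (fun z : G * G => \sum_x \sum_(y | (enum_rank x < enum_rank y)%N)
     ((J x y * cos (diff_angle (site_angle x) (site_angle y) z.1) +
       J' x y * cos (diff_angle (site_angle x) (site_angle y) z.2 + al x y)) +
      (K x y * cos (double_angle (diff_angle (site_angle x) (site_angle y)) z.1) +
       K' x y * cos (double_angle (diff_angle (site_angle x) (site_angle y)) z.2
          + 2 * al x y)))).
  apply/funext => z; rewrite /clock_energy /pairsum -big_split; apply: eq_bigr => x _.
  rewrite -big_split; apply: eq_bigr => y _ /=.
  by rewrite /zero_phase !addr0 (mulrDr 2 _ (al x y)) /=; ring.
apply: gap_mult_sum => x _; apply: gap_mult_sum => y xy.
have xy' : x != y by apply: contraTneq xy => ->; rewrite ltnn.
by apply: gap_multD; apply: gap_mult_cos; auto.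
Qed.

End clock.

(** * Polar coordinates in a plane *)

Section polar.
Context {R : realType}.

(** The sine of [acos (a / r)] is [|b| / r], so the angle changes sign with [b]. At the origin any
    angle will do. *)
Lemma polar (a b : R) : exists p : R * R,
  [/\ 0 <= p.1, a = p.1 * cos p.2 & b = p.1 * sin p.2].
Proof.
pose r := Num.sqrt (a ^+ 2 + b ^+ 2).
have r2 : r ^+ 2 = a ^+ 2 + b ^+ 2 by rewrite sqr_sqrtr// addr_ge0 ?sqr_ge0.
have r0 : 0 <= r by exact: sqrtr_ge0.
have [re|rn] := eqVneq r 0.
  move: r2; rewrite re expr0n => /esym/eqP.
  rewrite paddr_eq0 ?sqr_ge0// !sqrf_eq0 => /andP[/eqP -> /eqP ->].
  by exists (0, 0); rewrite /= !mul0r.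
have rp : 0 < r by rewrite lt_def rn.
pose c := a / r.
have ca : a = r * c by rewrite mulrC divfK.
have e : 1 - c ^+ 2 = (b / r) ^+ 2.
  by rewrite /c !expr_div_n -(divff (x := r ^+ 2)) ?sqrf_eq0// {1}r2 -mulrBl addrAC subrr add0r.
have c1 : -1 <= c <= 1.
  by rewrite -ler_norml -(ler_pXn2r (n := 2))// ?nnegrE// expr1n real_normK ?num_real// -subr_ge0 e sqr_ge0.
have cc : cos (acos c) = c by apply: acosK; rewrite in_itv.
have ss : sin (acos c) = `|b| / r.
  by rewrite sin_acos// e sqrtr_sqr normrM normfV (gtr0_norm rp).
have [b0|b0] := leP 0 b.
  exists (r, acos c); rewrite /= cc ss ger0_norm//; split=> //.
  by rewrite mulrC divfK.
exists (r, - acos c); rewrite /= cosN sinN cc ss ltr0_norm//; split=> //.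
by rewrite mulNr opprK mulrC divfK.
Qed.

End polar.

(** * Rotating the spins in a coordinate plane *)

Section spins.
Context {R : realType} {T : finType} {N : nat}.
Implicit Types (u : T * 'I_N -> R) (x y : T) (i j k : 'I_N).

Lemma sum_two (V : zmodType) i j (F : 'I_N -> V) : i != j ->
  \sum_k F k = F i + F j + \sum_(k | (k != i) && (k != j)) F k.
Proof.
by move=> ij; rewrite (bigD1 i)//= (bigD1 j) ?addrA//= eq_sym.
Qed.

Lemma siterot_fst i j c s u x : siterot i j c s u (x, i) = c x * u (x, i) - s x * u (x, j).
Proof. by rewrite /siterot /= eqxx. Qed.

Lemma siterot_snd i j c s u x : i != j ->
  siterot i j c s u (x, j) = s x * u (x, i) + c x * u (x, j).
Proof. by move=> ij; rewrite /siterot /= eq_sym (negbTE ij) eqxx. Qed.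

Lemma siterot_other i j c s u x k : k != i -> k != j -> siterot i j c s u (x, k) = u (x, k).
Proof. by move=> ki kj; rewrite /siterot /= (negbTE ki) (negbTE kj). Qed.

Lemma siterot_norm i j c s u x : i != j -> c x ^+ 2 + s x ^+ 2 = 1 ->
  \sum_k siterot i j c s u (x, k) ^+ 2 = \sum_k u (x, k) ^+ 2.
Proof.
move=> ij cs; rewrite !(sum_two _ i j)// siterot_fst siterot_snd//.
congr (_ + _); last by apply: eq_bigr => k /andP[ki kj]; rewrite siterot_other.
rewrite -[RHS]mul1r -cs; ring.
Qed.

Lemma spin_siterot i j c s u x k : i != j -> c x ^+ 2 + s x ^+ 2 = 1 ->
  spin (siterot i j c s u) x k = siterot i j c s (fun z => spin u z.1 z.2) (x, k).
Proof.
move=> ij cs; rewrite /spin siterot_norm// /siterot /=.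
by case: ifP => _; [|case: ifP => // _]; ring.
Qed.

(* Not an equality: the spin of the zero vector is zero. *)
Lemma spin_norm_le1 u x : \sum_k spin u x k ^+ 2 <= 1.
Proof.
rewrite /spin; set S := \sum_(j < N) u (x, j) ^+ 2.
have S0 : 0 <= S by apply: sumr_ge0 => k _; exact: sqr_ge0.
under eq_bigr do rewrite expr_div_n sqr_sqrtr//.
rewrite -mulr_suml -/S; have [->|Sn] := eqVneq S 0; first by rewrite mul0r.
by rewrite divff.
Qed.

Definition plane_dot i j u x y : R := spin u x i * spin u y i + spin u x j * spin u y j.

(** The spin-2 scalar product of the projections: it pairs (r^2 cos 2 phi, r^2 sin 2 phi) at the two
    sites. The factor 4 comes from r^2 sin 2 phi being twice the product of the two components. *)
Definition plane_dot2 i j u x y : R :=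
  (spin u x i ^+ 2 - spin u x j ^+ 2) * (spin u y i ^+ 2 - spin u y j ^+ 2)
  + 4 * (spin u x i * spin u x j * spin u y i * spin u y j).

Definition plane_norm2 i j u x : R := spin u x i ^+ 2 + spin u x j ^+ 2.

Definition rest_dot i j u x y : R :=
  \sum_(k | (k != i) && (k != j)) spin u x k * spin u y k.

Lemma sdot_plane i j u x y : i != j -> sdot u x y = plane_dot i j u x y + rest_dot i j u x y.
Proof. by move=> ij; rewrite /sdot (sum_two _ i j). Qed.

(** The arithmetic-geometric inequality is applied in each coordinate, which avoids Cauchy-Schwarz.
    The bound implies |r| <= 1 - a because r_x r_y <= (r_x^2 + r_y^2) / 2. *)
Lemma rest_dot_le i j u x y : i != j ->
  `|rest_dot i j u x y| <= 1 - (plane_norm2 i j u x + plane_norm2 i j u y) / 2.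
Proof.
move=> ij; apply: (le_trans (ler_norm_sum _ _ _)).
have h x0 : \sum_(k | (k != i) && (k != j)) spin u x0 k ^+ 2 <= 1 - plane_norm2 i j u x0.
  by have := spin_norm_le1 u x0; rewrite (sum_two _ i j) // /plane_norm2; lra.
apply: (@le_trans _ _ (\sum_(k | (k != i) && (k != j))
    (spin u x k ^+ 2 / 2 + spin u y k ^+ 2 / 2))).
  apply: ler_sum => k _; rewrite normrM.
  have := sqr_ge0 (`|spin u x k| - `|spin u y k|).
  by rewrite sqrrB !real_normK ?num_real//; lra.
rewrite big_split /= -!mulr_suml; have := h x; have := h y; lra.
Qed.

Lemma plane_norm2_siterot i j c s u x : i != j -> c x ^+ 2 + s x ^+ 2 = 1 ->
  plane_norm2 i j (siterot i j c s u) x = plane_norm2 i j u x.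
Proof.
move=> ij cs; rewrite /plane_norm2 !spin_siterot// siterot_fst siterot_snd//=.
rewrite -[RHS]mul1r -cs; ring.
Qed.

Lemma rest_dot_siterot i j c s u x y : i != j ->
  (forall z, c z ^+ 2 + s z ^+ 2 = 1) ->
  rest_dot i j (siterot i j c s u) x y = rest_dot i j u x y.
Proof.
move=> ij cs; apply: eq_bigr => k /andP[ki kj].
by rewrite !spin_siterot// !siterot_other.
Qed.

(** Expand the square of a cos D + r and use cos^2 D = (1 + cos 2D) / 2. The terms free of D,
    including the constant half of the last identity, form the factor independent of [th]. *)
Lemma Nweight_siterot i j (J' K' : T -> T -> R) u (r phi th : T -> R) : i != j ->
  (forall x, spin u x i = r x * cos (phi x)) ->
  (forall x, spin u x j = r x * sin (phi x)) ->
  Nweight J' K' (siterot i j (fun x => cos (th x)) (fun x => sin (th x)) u) =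
  expR (pairsum (fun x y =>
      (J' x y * (r x * r y) + K' x y * (r x * r y) * rest_dot i j u x y) *
        cos (th x - th y + (phi x - phi y))
    + 4^-1 * K' x y * (r x * r y) ^+ 2 * cos (2 * (th x - th y + (phi x - phi y)))))
  * (expR (pairsum (fun x y => J' x y * rest_dot i j u x y
      + 2^-1 * K' x y * rest_dot i j u x y ^+ 2 + 4^-1 * K' x y * (r x * r y) ^+ 2))
    * \prod_(x : T) (if \sum_(k < N) u (x, k) ^+ 2 <= 1 then 1 else 0)).
Proof.
move=> ij pc ps.
have cs z : (fun x => cos (th x)) z ^+ 2 + (fun x => sin (th x)) z ^+ 2 = 1.
  exact: cos2Dsin2.
rewrite /Nweight mulrA -expRD; congr (expR _ * _); last first.
  by apply: eq_bigr => x _; rewrite siterot_norm.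
rewrite /pairsum -big_split; apply: eq_bigr => x _.
rewrite -big_split; apply: eq_bigr => y _ /=.
have -> : sdot (siterot i j (fun x => cos (th x)) (fun x => sin (th x)) u) x y
    = r x * r y * cos (th x - th y + (phi x - phi y)) + rest_dot i j u x y.
  rewrite (sdot_plane i j)// rest_dot_siterot//; congr (_ + _).
  rewrite /plane_dot !spin_siterot// !siterot_fst !siterot_snd//= !pc !ps.
  have -> : th x - th y + (phi x - phi y) = (th x + phi x) - (th y + phi y) by ring.
  by rewrite cosB !cosD !sinD; ring.
set D := th x - th y + (phi x - phi y).
have -> : cos (2 * D) = 2 * cos D ^+ 2 - 1.
  by rewrite mulr_natl cos_mulr2n -mulr_natl.
by field.
Qed.

Lemma plane_dot_siterot i j u (r phi th : T -> R) x y : i != j ->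
  (forall x, spin u x i = r x * cos (phi x)) ->
  (forall x, spin u x j = r x * sin (phi x)) ->
  plane_dot i j (siterot i j (fun x => cos (th x)) (fun x => sin (th x)) u) x y =
  r x * r y * cos (th x - th y + (phi x - phi y)).
Proof.
move=> ij pc ps.
have cs z : (fun x => cos (th x)) z ^+ 2 + (fun x => sin (th x)) z ^+ 2 = 1.
  exact: cos2Dsin2.
rewrite /plane_dot !spin_siterot// !siterot_fst !siterot_snd//= !pc !ps.
have -> : th x - th y + (phi x - phi y) = (th x + phi x) - (th y + phi y) by ring.
by rewrite cosB !cosD !sinD; ring.
Qed.

Lemma plane_dot2_siterot i j u (r phi th : T -> R) x y : i != j ->
  (forall x, spin u x i = r x * cos (phi x)) ->
  (forall x, spin u x j = r x * sin (phi x)) ->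
  plane_dot2 i j (siterot i j (fun x => cos (th x)) (fun x => sin (th x)) u) x y =
  (r x * r y) ^+ 2 * cos (2 * (th x - th y + (phi x - phi y))).
Proof.
move=> ij pc ps.
have cs z : (fun x => cos (th x)) z ^+ 2 + (fun x => sin (th x)) z ^+ 2 = 1.
  exact: cos2Dsin2.
rewrite /plane_dot2 !spin_siterot// !siterot_fst !siterot_snd//= !pc !ps.
have -> : 2 * (th x - th y + (phi x - phi y)) =
  2 * (th x + phi x) - 2 * (th y + phi y) by ring.
have c2 (a : R) : cos (2 * a) = 2 * cos a ^+ 2 - 1 by rewrite mulr_natl cos_mulr2n mulr_natl.
have s2 (a : R) : sin (2 * a) = 2 * (cos a * sin a) by rewrite mulr_natl sin_mulr2n mulr_natl.
rewrite cosB !c2 !s2.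
have -> : cos (th x) * (r x * cos (phi x)) - sin (th x) * (r x * sin (phi x))
  = r x * cos (th x + phi x) by rewrite cosD; ring.
have -> : sin (th x) * (r x * cos (phi x)) + cos (th x) * (r x * sin (phi x))
  = r x * sin (th x + phi x) by rewrite sinD; ring.
have -> : cos (th y) * (r y * cos (phi y)) - sin (th y) * (r y * sin (phi y))
  = r y * cos (th y + phi y) by rewrite cosD; ring.
have -> : sin (th y) * (r y * cos (phi y)) + cos (th y) * (r y * sin (phi y))
  = r y * sin (th y + phi y) by rewrite sinD; ring.
rewrite !exprMn !sin2cos2; ring.
Qed.

(** The hypothesis on [b] is exactly a bound on the maximum over [0, 1] of |J| a + |K| a (1 - a).
    When |K| <= |J| this is increasing, with maximum |J| at a = 1; otherwise its vertex (|K| + |J|)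
    / (2 |K|) lies in the interval. *)
Lemma effective_vector_coupling (J K a r b : R) :
  0 <= a <= 1 -> `|r| <= 1 - a ->
  (if `|K| <= `|J| then `|J| else 4^-1 * `|K| * (1 + `|J| / `|K|) ^+ 2) <= b ->
  `|J * a + K * a * r| <= b.
Proof.
move=> /andP[a0 a1] hr; apply: le_trans.
have : `|J * a + K * a * r| <= `|J| * a + `|K| * a * (1 - a).
  apply: (le_trans (ler_normD _ _)); rewrite !normrM (ger0_norm a0).
  by rewrite lerD2l; apply: ler_wpM2l => //; rewrite mulr_ge0.
move/le_trans; apply.
have J0 := normr_ge0 J; have K0 := normr_ge0 K.
case: (leP `|K| `|J|) => h.
  have : `|K| * (a * (1 - a)) <= `|J| * (1 - a).
    apply: ler_pM => //; first by rewrite mulr_ge0 ?subr_ge0.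
    by have := sqr_ge0 (1 - a); rewrite expr2; lra.
  lra.
have kp : 0 < `|K| by exact: le_lt_trans h.
have -> : 4^-1 * `|K| * (1 + `|J| / `|K|) ^+ 2 = (`|K| + `|J|) ^+ 2 / (4 * `|K|).
  by field; rewrite gt_eqF.
rewrite ler_pdivlMr ?mulr_gt0//.
(* This square vanishes at the vertex of the parabola. *)
have := sqr_ge0 (`|K| + `|J| - 2 * `|K| * a); nra.
Qed.

End spins.

(** * Averaging over grid rotations *)

Section tame_closure.
Context {R : realType} {I : eqType}.
Implicit Types (F : (I -> R) -> R) (s : seq I).

Lemma comeasurableD F F' : comeasurable F -> comeasurable F' ->
  comeasurable (fun v => F v + F' v).
Proof. by move=> mF mF' d X v mv; apply: measurable_funD; [exact: mF|exact: mF']. Qed.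

Lemma comeasurableM F F' : comeasurable F -> comeasurable F' ->
  comeasurable (fun v => F v * F' v).
Proof. by move=> mF mF' d X v mv; apply: measurable_funM; [exact: mF|exact: mF']. Qed.

Lemma comeasurable_cst (c : R) : comeasurable (fun _ : I -> R => c).
Proof. by move=> d X v mv; exact: measurable_cst. Qed.

Lemma comeasurable_proj i : comeasurable (fun v : I -> R => v i).
Proof. by move=> d X v mv; exact: mv. Qed.

Lemma comeasurable_real (f : R -> R) F : measurable_fun setT f -> comeasurable F ->
  comeasurable (fun v => f (F v)).
Proof.
by move=> mf mF d X v mv; apply: (measurableT_comp mf); exact: mF.
Qed.

Lemma comeasurable_sum (J : Type) (r : seq J) (P : pred J) (F : J -> (I -> R) -> R) :
  (forall j, comeasurable (F j)) -> comeasurable (fun v => \sum_(j <- r | P j) F j v).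
Proof.
move=> mF d X v mv; under eq_fun do rewrite big_mkcond.
by apply: measurable_sum => j; case: (P j); [exact: mF|exact: measurable_cst].
Qed.

Lemma comeasurableX F k : comeasurable F -> comeasurable (fun v => F v ^+ k).
Proof.
move=> mF; elim: k => [|k IH]; first exact: comeasurable_cst.
by under eq_fun do rewrite exprS; apply: (comeasurableM F (fun v => F v ^+ k) mF IH).
Qed.

Lemma tame0 s : tame s (fun _ : I -> R => 0).
Proof.
split; [exact: comeasurable_cst|exists 0 => v; rewrite normr0//|by exists 0].
Qed.

Lemma tameD s F F' : tame s F -> tame s F' -> tame s (fun v => F v + F' v).
Proof.
move=> [mF [M bF] [B sF]] [mF' [M' bF'] [B' sF']]; split.
- exact: comeasurableD.
- by exists (M + M') => v; apply: (le_trans (ler_normD _ _)); exact: lerD.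
exists (Num.max B B') => v i si; rewrite gt_max => /andP[h h'].
by rewrite (sF _ i)// (sF' _ i)// addr0.
Qed.

Lemma tameZ s c F : tame s F -> tame s (fun v => c * F v).
Proof.
move=> [mF [M bF] [B sF]]; split.
- by apply: comeasurableM => //; exact: comeasurable_cst.
- by exists (`|c| * M) => v; rewrite normrM ler_wpM2l.
by exists B => v i si h; rewrite (sF _ i)// mulr0.
Qed.

Lemma tame_sum s (J : Type) (r : seq J) (P : pred J) (F : J -> (I -> R) -> R) :
  (forall j, tame s (F j)) -> tame s (fun v => \sum_(j <- r | P j) F j v).
Proof.
move=> tF; elim: r => [|j r IH].
  by under eq_fun do rewrite big_nil; exact: tame0.
under eq_fun do rewrite big_cons.
by case: (P j) => //; exact: tameD.
Qed.

End tame_closure.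

Section fint_linear.
Context {R : realType} {I : finType}.
Implicit Types F : (I -> R) -> R.

Lemma fintD F F' : tame (enum I) F -> tame (enum I) F' ->
  fint setT (fun v => F v + F' v) = fint setT F + fint setT F'.
Proof. by move=> tF tF'; apply: iterintD => //; exact: enum_uniq. Qed.

Lemma fintZ c F : tame (enum I) F ->
  fint setT (fun v => c * F v) = c * fint setT F.
Proof. by move=> tF; apply: iterintZ => //; exact: enum_uniq. Qed.

Lemma fint_sum (J : Type) (r : seq J) (P : pred J) (F : J -> (I -> R) -> R) :
  (forall j, tame (enum I) (F j)) ->
  fint setT (fun v => \sum_(j <- r | P j) F j v) = \sum_(j <- r | P j) fint setT (F j).
Proof.
move=> tF; elim: r => [|j r IH].
  rewrite big_nil; under eq_fun do rewrite big_nil.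
  have := fintZ 0 (fun=> 0) (tame0 _); by rewrite !mul0r.
rewrite big_cons; under eq_fun do rewrite big_cons.
by case: (P j); rewrite ?fintD ?IH//; exact: tame_sum.
Qed.

Lemma fint_le F F' : tame (enum I) F -> tame (enum I) F' ->
  (forall v, F v <= F' v) -> fint setT F <= fint setT F'.
Proof. by move=> tF tF' h; apply: iterint_le => //; exact: enum_uniq. Qed.

End fint_linear.

Definition grid_rot {R : realType} {T : finType} {N n : nat} (i j : 'I_N)
    (g : {ffun T -> 'I_n.+1}) : (T * 'I_N -> R) -> T * 'I_N -> R :=
  siterot i j (fun x => cos (clock_angle g x)) (fun x => sin (clock_angle g x)).

(** * Averages over the grid, and boundedness and support of the spin weight *)

Section N_model.
Context {R : realType} {T : finType} {N : nat}.
Implicit Types (u : T * 'I_N -> R) (x y : T) (i j k : 'I_N) (J K : T -> T -> R).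
Local Notation tameT := (tame (enum {: T * 'I_N})).

(** By rotation invariance every term of a grid sum has the same integral, so both sides acquire the
    number of grid points as a common factor. *)
Lemma fint_grid_average (n : nat) i j (F F' : (T * 'I_N -> R) -> R) (Z C : R) :
  i != j -> tameT F -> tameT F' ->
  (forall u, Z * \sum_(g : {ffun T -> 'I_n.+1}) F (grid_rot i j g u) <=
     C * \sum_(g : {ffun T -> 'I_n.+1}) F' (grid_rot i j g u)) ->
  Z * fint setT F <= C * fint setT F'.
Proof.
move=> ij tF tF' h.
have av H : tameT H -> tameT (fun u => \sum_(g : {ffun T -> 'I_n.+1}) H (grid_rot i j g u))
   /\ fint setT (fun u => \sum_(g : {ffun T -> 'I_n.+1}) H (grid_rot i j g u))
    = #|{ffun T -> 'I_n.+1}|%:R * fint setT H.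
  move=> tH.
  have r (g : {ffun T -> 'I_n.+1}) := @tame_siterot R T N i j _ _ H ij
    (fun x => cos2Dsin2 (clock_angle g x)) tH.
  split; first by apply: tame_sum => g; case: (r g).
  rewrite fint_sum; last by move=> g; case: (r g).
  under eq_bigr => g _ do rewrite (proj2 (r g)).
  by rewrite sumr_const mulr_natl.
have [t1 e1] := av _ tF; have [t2 e2] := av _ tF'.
have := fint_le _ _ (tameZ _ Z _ t1) (tameZ _ C _ t2) h.
rewrite !fintZ// e1 e2 ![_ * (_%:R * _)]mulrCA ler_pM2l// ltr0n.
by apply/card_gt0P; exists 0.
Qed.

Lemma comeasurable_spin x k : comeasurable (fun u => spin u x k).
Proof.
(* As a real power the normalization is one measurable function on the whole line, with value 0 at 0
   as for the inverse, so the zero vector needs no separate case. *)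
rewrite (_ : (fun u => _) = (fun u => u (x, k) *
    (\sum_(j < N) u (x, j) ^+ 2) `^ (- 2^-1))); last first.
  apply/funext => u; rewrite /spin powRN powR12_sqrt//.
  by apply: sumr_ge0 => l _; exact: sqr_ge0.
apply: comeasurableM; first exact: comeasurable_proj.
apply: (comeasurable_real (fun r => r `^ (- 2^-1))); first exact: measurable_powR.
by apply: comeasurable_sum => l; apply: comeasurableX; exact: comeasurable_proj.
Qed.

Lemma comeasurable_sdot x y : comeasurable (fun u => sdot u x y).
Proof.
by apply: comeasurable_sum => k; apply: comeasurableM; exact: comeasurable_spin.
Qed.

Lemma spin_le1 u x k : `|spin u x k| <= 1.
Proof.
rewrite -(ler_pXn2r (n := 2))// ?nnegrE// expr1n real_normK ?num_real//.
apply: le_trans (spin_norm_le1 u x).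
by rewrite (bigD1 k)//= lerDl; apply: sumr_ge0 => l _; exact: sqr_ge0.
Qed.

Lemma sdot_le1 u x y : `|sdot u x y| <= 1.
Proof.
apply: (le_trans (ler_norm_sum _ _ _)).
apply: (@le_trans _ _ (\sum_k (spin u x k ^+ 2 / 2 + spin u y k ^+ 2 / 2))).
  apply: ler_sum => k _; rewrite normrM.
  have := sqr_ge0 (`|spin u x k| - `|spin u y k|).
  by rewrite sqrrB !real_normK ?num_real//; lra.
rewrite big_split /= -!mulr_suml.
have := spin_norm_le1 u x; have := spin_norm_le1 u y; lra.
Qed.

Lemma Nweight_ge0 J' K' u : 0 <= Nweight J' K' u.
Proof.
rewrite /Nweight mulr_ge0 ?expR_ge0//; apply: prodr_ge0 => x _.
by case: ifP.
Qed.

Lemma comeasurable_Nweight J' K' : comeasurable (@Nweight R T N J' K').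
Proof.
apply: comeasurableM.
  apply: comeasurable_real; first exact: measurable_expR.
  rewrite /pairsum; apply: comeasurable_sum => x; apply: comeasurable_sum => y.
  apply: comeasurableD; apply: comeasurableM; do ?exact: comeasurable_cst.
    exact: comeasurable_sdot.
  apply: comeasurableX; exact: comeasurable_sdot.
move=> d X v mv; apply: measurable_prod => x _.
apply: measurable_fun_ifT; do ?exact: measurable_cst.
apply: measurable_fun_ler; last exact: measurable_cst.
apply: (comeasurable_sum _ _ _ (fun k u => u (x, k) ^+ 2)) => // k.
by apply: comeasurableX; exact: comeasurable_proj.
Qed.

Lemma tame_weighted J' K' (f : (T * 'I_N -> R) -> R) :
  comeasurable f -> (exists M, forall u, `|f u| <= M) ->
  tameT (fun u => f u * Nweight J' K' u).
Proof.
move=> mf [M bf]; split.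
- by apply: comeasurableM => //; exact: comeasurable_Nweight.
- exists (M * expR (pairsum (fun x y => `|J' x y| + 2^-1 * `|K' x y|))) => u.
  rewrite normrM ler_pM// ger0_norm ?Nweight_ge0// /Nweight.
  rewrite -[leRHS]mulr1 ler_pM ?expR_ge0//.
  + by apply: prodr_ge0 => x _; case: ifP.
  + rewrite ler_expR; apply: ler_sum => x _; apply: ler_sum => y _.
    apply: (le_trans (ler_norm _)); apply: (le_trans (ler_normD _ _)).
    have s1 := sdot_le1 u x y.
    have s2 : `|sdot u x y ^+ 2| <= 1 by rewrite normrX exprn_ile1.
    rewrite [`|J' x y * _|]normrM [`|_ * _ ^+ 2|]normrM [`|2^-1 * _|]normrM.
    rewrite (ger0_norm (x := 2^-1)) ?invr_ge0//.
    by rewrite lerD// ler_piMr// mulr_ge0 ?invr_ge0.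
  + by apply: prodr_ile1 => x _; case: ifP; rewrite ?ler01 ?lexx.
(* The indicator of the unit ball at site [x] vanishes as soon as one coordinate there exceeds 1 in
   absolute value. *)
exists 1 => u [x k] _ h; rewrite /Nweight (bigD1 x)//= ifF ?mul0r ?mulr0//.
apply/negbTE; rewrite -ltNge; apply: (@lt_le_trans _ _ (u (x, k) ^+ 2)).
  by rewrite -real_normK ?num_real// exprn_egt1.
by rewrite (bigD1 k)//= lerDl; apply: sumr_ge0 => l _; exact: sqr_ge0.
Qed.

End N_model.

(** * Comparison with the clock model *)

Definition clock_Z {R : realType} {T : finType} (n : nat) (J K : T -> T -> R) : R :=
  \sum_(g : {ffun T -> 'I_n.+1}) expR (clock_energy J K zero_phase g).

Definition clock_cos {R : realType} {T : finType} (n : nat) (J K : T -> T -> R)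
    (m : R) (x y : T) : R :=
  \sum_(g : {ffun T -> 'I_n.+1}) cos (m * (clock_angle g x - clock_angle g y)) *
    expR (clock_energy J K zero_phase g).

Section comparison.
Context {R : realType} {T : finType} {N n : nat}.
Context (n_even : ~~ odd n) (J' K' J K : T -> T -> R).
Local Notation G := {ffun T -> 'I_n.+1}.
Context (hJ : forall x y : T, x != y ->
     (if `|K' x y| <= `|J' x y| then `|J' x y|
      else 4^-1 * `|K' x y| * (1 + `|J' x y| / `|K' x y|) ^+ 2) <= J x y)
  (hK : forall x y : T, x != y -> 4^-1 * `|K' x y| <= K x y).
Implicit Types (u : T * 'I_N -> R) (x y : T) (i j k : 'I_N).

Lemma J_ge0 x y : x != y -> 0 <= J x y.
Proof.
move=> xy; apply: le_trans (hJ _ _ xy); case: ifP => // _.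
Qed.

Lemma K_ge0 x y : x != y -> 0 <= K x y.
Proof. by move=> xy; apply: le_trans (hK _ _ xy); rewrite mulr_ge0 ?invr_ge0. Qed.

Lemma clock_Z_gt0 : 0 < clock_Z n J K.
Proof.
rewrite /clock_Z (bigD1 (0 : G))//= ltr_pwDl ?expR_gt0//.
by apply: sumr_ge0 => g _; exact: expR_ge0.
Qed.

Lemma clock_ginibre (Jt Kt al : T -> T -> R) (A : @angle R T n) (b : R) :
  (forall x y, x != y -> `|Jt x y| <= J x y) ->
  (forall x y, x != y -> `|Kt x y| <= K x y) ->
  clock_Z n J K * (\sum_(g : G) cos (A g + b) * expR (clock_energy Jt Kt al g)) <=
  (\sum_(g : G) cos (A g) * expR (clock_energy J K zero_phase g)) *
  (\sum_(g : G) expR (clock_energy Jt Kt al g)).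
Proof.
by move=> h1 h2; apply: (ginibre n_even); exact: clock_gap_mult.
Qed.

(** Compare with the model without couplings, once with shift 0 and once with shift pi. Its
    correlation enters with opposite signs, so the sum of the two inequalities leaves only the
    desired one. *)
Lemma clock_cos_angle_ge0 (A : @angle R T n) :
  0 <= \sum_(g : G) cos (A g) * expR (clock_energy J K zero_phase g).
Proof.
pose z (x y : T) : R := 0.
have zJ x y : x != y -> `|z x y| <= J x y by rewrite normr0; exact: J_ge0.
have zK x y : x != y -> `|z x y| <= K x y by rewrite normr0; exact: K_ge0.
have e (g : G) : clock_energy z z z g = 0 :> R.
  by rewrite /clock_energy /pairsum big1// => x _; rewrite big1// => y _; rewrite !mul0r addr0.
have := clock_ginibre z z z A 0 zJ zK; have := clock_ginibre z z z A pi zJ zK.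
under eq_bigr do rewrite cosDpi e expR0 mulr1.
under [X in _ <= _ * X -> _]eq_bigr do rewrite e expR0.
under [X in _ -> _ * X <= _ -> _]eq_bigr do rewrite addr0 e expR0 mulr1.
under [X in _ -> _ <= _ * X -> _]eq_bigr do rewrite e expR0.
rewrite sumrN mulrN sumr_const; set C := \sum_(g : G) _ * expR _; set S := \sum_(g : G) _.
set c : R := _ *+ _; have c0 : 0 < c.
  by rewrite /c -[_ *+ _]/(#|_|%:R) ltr0n; apply/card_gt0P; exists 0.
move=> h1 h2; have : 0 <= C * c by lra.
by rewrite pmulr_lge0.
Qed.

Lemma clock_cos1_ge0 x y : 0 <= clock_cos n J K 1 x y.
Proof.
have := clock_cos_angle_ge0 (diff_angle (site_angle x) (site_angle y)).
by rewrite /clock_cos; under [X in _ -> _ <= X]eq_bigr do rewrite mul1r.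
Qed.

Lemma clock_cos2_ge0 x y : 0 <= clock_cos n J K 2 x y.
Proof. exact: (clock_cos_angle_ge0 (double_angle (diff_angle (site_angle x) (site_angle y)))). Qed.

Section fixed_configuration.
Context (i j : 'I_N) (ij : i != j) (u : T * 'I_N -> R).

Lemma spin_polar : exists r phi : T -> R,
  [/\ forall x, 0 <= r x, forall x, spin u x i = r x * cos (phi x)
    & forall x, spin u x j = r x * sin (phi x)].
Proof.
have /choice[f fP] x := polar (spin u x i) (spin u x j).
by exists (fun x => (f x).1), (fun x => (f x).2); split=> x; case: (fP x).
Qed.

Lemma grid_Nweight (r phi : T -> R) : (forall x, 0 <= r x) ->
  (forall x, spin u x i = r x * cos (phi x)) ->
  (forall x, spin u x j = r x * sin (phi x)) ->
  exists Jt Kt : T -> T -> R, exists c : R,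
  [/\ forall x y, x != y -> `|Jt x y| <= J x y,
      forall x y, x != y -> `|Kt x y| <= K x y, 0 <= c
    & forall g : G, Nweight J' K' (grid_rot i j g u) =
        expR (clock_energy Jt Kt (fun x y => phi x - phi y) g) * c].
Proof.
move=> r0 pc ps.
have rn x : plane_norm2 i j u x = r x ^+ 2.
  by rewrite /plane_norm2 pc ps !exprMn -mulrDr cos2Dsin2 mulr1.
have r1 x : r x <= 1.
  rewrite -(ler_pXn2r (n := 2))// ?nnegrE// expr1n -rn.
  have := spin_norm_le1 u x; rewrite (sum_two _ i j)// /plane_norm2.
  have : 0 <= \sum_(k | (k != i) && (k != j)) spin u x k ^+ 2.
    by apply: sumr_ge0 => k _; exact: sqr_ge0.
  lra.
have a1 x y : 0 <= r x * r y <= 1 by rewrite mulr_ge0//= mulr_ile1.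
(* The couplings, and the factor that does not depend on [g], are read off from [Nweight_siterot],
   so the formula for the weight is settled first. *)
eexists; eexists; eexists; split; last first.
- by move=> g; rewrite /grid_rot (Nweight_siterot i j J' K' u r phi).
- by rewrite mulr_ge0 ?expR_ge0//; apply: prodr_ge0 => x _; case: ifP.
- move=> x y xy /=; apply: le_trans (hK _ _ xy); rewrite [`|_ * _ ^+ 2|]normrM [`|4^-1 * _|]normrM normrX.
  rewrite (ger0_norm (x := 4^-1)) ?invr_ge0// ler_piMr ?mulr_ge0 ?invr_ge0//.
  by have /andP[? ?] := a1 x y; rewrite ger0_norm// exprn_ile1.
- move=> x y xy /=; apply: effective_vector_coupling; [exact: a1| |exact: hJ].
  apply: (le_trans (rest_dot_le i j u x y ij)); rewrite !rn.
  have := sqr_ge0 (r x - r y); rewrite sqrrB; lra.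
Qed.

(** The sign is a phase shift by pi; both signs together will give the absolute value. On the right
    r_x r_y is replaced by (r_x^2 + r_y^2) / 2, which is polynomial in the spins and can be summed
    over planes; this uses that the clock correlation is nonnegative. *)
Lemma grid_plane_dot_le (b : bool) x y :
  clock_Z n J K * \sum_(g : G) ((-1) ^+ b * plane_dot i j (grid_rot i j g u) x y *
      Nweight J' K' (grid_rot i j g u)) <=
  clock_cos n J K 1 x y * \sum_(g : G)
    ((plane_norm2 i j (grid_rot i j g u) x + plane_norm2 i j (grid_rot i j g u) y) / 2 *
      Nweight J' K' (grid_rot i j g u)).
Proof.
have [r [phi [r0 pc ps]]] := spin_polar.
have rn x0 : plane_norm2 i j u x0 = r x0 ^+ 2.
  by rewrite /plane_norm2 pc ps !exprMn -mulrDr cos2Dsin2 mulr1.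
have [Jt [Kt [c [h1 h2 c0 hW]]]] := grid_Nweight r phi r0 pc ps.
set al := (fun x y => phi x - phi y) in hW.
have gin := clock_ginibre Jt Kt al (diff_angle (site_angle x) (site_angle y))
  (al x y + b%:R * pi) h1 h2.
have cb (t : R) : cos (t + b%:R * pi) = (-1) ^+ b * cos t.
  by case: b {gin}; rewrite /= ?mul1r ?mul0r ?addr0 ?expr0 ?expr1 ?mul1r ?mulN1r ?cosDpi.
set S1 := \sum_(g : G) cos _ * _ in gin; set S2 := \sum_(g : G) expR _ in gin.
have -> : \sum_(g : G) ((-1) ^+ b * plane_dot i j (grid_rot i j g u) x y *
      Nweight J' K' (grid_rot i j g u)) = r x * r y * c * S1.
  rewrite mulr_sumr; apply: eq_bigr => g _.
  rewrite hW /grid_rot (plane_dot_siterot i j u r phi)// [_ + (al x y + _)]addrA cb /=; ring.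
have -> : \sum_(g : G) ((plane_norm2 i j (grid_rot i j g u) x
     + plane_norm2 i j (grid_rot i j g u) y) / 2 * Nweight J' K' (grid_rot i j g u))
   = (r x ^+ 2 + r y ^+ 2) / 2 * c * S2.
  rewrite mulr_sumr; apply: eq_bigr => g _.
  rewrite hW /grid_rot !plane_norm2_siterot// ?cos2Dsin2// !rn; ring.
have -> : clock_cos n J K 1 x y = \sum_(g : G) cos (diff_angle (site_angle x) (site_angle y) g)
    * expR (clock_energy J K zero_phase g).
  by rewrite /clock_cos; under eq_bigr do rewrite mul1r.
have C0 := clock_cos_angle_ge0 (diff_angle (site_angle x) (site_angle y)).
set C := \sum_(g : G) cos (diff_angle _ _ _) * _ in gin C0 *.
have S20 : 0 <= S2 by apply: sumr_ge0 => g _; exact: expR_ge0.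
apply: (@le_trans _ _ (r x * r y * c * (C * S2))).
  rewrite mulrCA ler_wpM2l// !mulr_ge0//.
rewrite [leRHS]mulrCA.
rewrite ler_wpM2r ?mulr_ge0// ler_wpM2r//.
by have := sqr_ge0 (r x - r y); rewrite sqrrB; lra.
Qed.

(** Here the prefactor (r_x r_y)^2 is already the product of the two plane norms, so nothing is
    lost. *)
Lemma grid_plane_dot2_le x y :
  clock_Z n J K * \sum_(g : G) (plane_dot2 i j (grid_rot i j g u) x y *
      Nweight J' K' (grid_rot i j g u)) <=
  clock_cos n J K 2 x y * \sum_(g : G)
    (plane_norm2 i j (grid_rot i j g u) x * plane_norm2 i j (grid_rot i j g u) y *
      Nweight J' K' (grid_rot i j g u)).
Proof.
have [r [phi [r0 pc ps]]] := spin_polar.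
have rn x0 : plane_norm2 i j u x0 = r x0 ^+ 2.
  by rewrite /plane_norm2 pc ps !exprMn -mulrDr cos2Dsin2 mulr1.
have [Jt [Kt [c [h1 h2 c0 hW]]]] := grid_Nweight r phi r0 pc ps.
set al := (fun x y => phi x - phi y) in hW.
have gin := clock_ginibre Jt Kt al (double_angle (diff_angle (site_angle x) (site_angle y)))
  (2 * al x y) h1 h2.
set S1 := \sum_(g : G) cos _ * _ in gin; set S2 := \sum_(g : G) expR _ in gin.
have -> : \sum_(g : G) (plane_dot2 i j (grid_rot i j g u) x y *
      Nweight J' K' (grid_rot i j g u)) = (r x * r y) ^+ 2 * c * S1.
  rewrite mulr_sumr; apply: eq_bigr => g _.
  by rewrite hW /grid_rot (plane_dot2_siterot i j u r phi)// mulrDr /=; ring.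
have -> : \sum_(g : G) (plane_norm2 i j (grid_rot i j g u) x
     * plane_norm2 i j (grid_rot i j g u) y * Nweight J' K' (grid_rot i j g u))
   = (r x * r y) ^+ 2 * c * S2.
  rewrite mulr_sumr; apply: eq_bigr => g _.
  rewrite hW /grid_rot !plane_norm2_siterot// ?cos2Dsin2// !rn; ring.
by rewrite ![_ * (_ * c * _)]mulrCA ler_wpM2l// mulr_ge0// sqr_ge0.
Qed.

End fixed_configuration.

End comparison.

(** * Integrated comparison *)

Definition observable {R : realType} {I : Type} (f : (I -> R) -> R) :=
  comeasurable f /\ exists M, forall u, `|f u| <= M.

Definition Nint {R : realType} {T : finType} {N : nat} (J' K' : T -> T -> R)
    (f : (T * 'I_N -> R) -> R) : R := fint setT (fun u => f u * Nweight J' K' u).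

Section observables.
Context {R : realType} {I : eqType}.
Implicit Types f : (I -> R) -> R.

Lemma observable_cst (c : R) : observable (fun _ : I -> R => c).
Proof. by split; [exact: comeasurable_cst|exists `|c|]. Qed.

Lemma observableD f f' : observable f -> observable f' -> observable (fun u => f u + f' u).
Proof.
move=> [mf [M bf]] [mf' [M' bf']]; split; first exact: comeasurableD.
by exists (M + M') => u; apply: (le_trans (ler_normD _ _)); exact: lerD.
Qed.

Lemma observableM f f' : observable f -> observable f' -> observable (fun u => f u * f' u).
Proof.
move=> [mf [M bf]] [mf' [M' bf']]; split; first exact: comeasurableM.
by exists (M * M') => u; rewrite normrM ler_pM.
Qed.

Lemma observableX f k : observable f -> observable (fun u => f u ^+ k).
Proof.
move=> of_; elim: k => [|k IH]; first exact: observable_cst.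
by under eq_fun do rewrite exprS; apply: (observableM f (fun u => f u ^+ k)).
Qed.

Lemma observableB f f' : observable f -> observable f' -> observable (fun u => f u - f' u).
Proof.
move=> of_ of'; under eq_fun do rewrite -mulN1r.
by apply: (observableD f) => //; apply: (observableM (fun=> -1)) => //; exact: observable_cst.
Qed.

Lemma observable_sum (J : Type) (r : seq J) (P : pred J) (f : J -> (I -> R) -> R) :
  (forall j, observable (f j)) -> observable (fun u => \sum_(j <- r | P j) f j u).
Proof.
move=> of_; elim: r => [|j r IH].
  by under eq_fun do rewrite big_nil; exact: observable_cst.
by under eq_fun do rewrite big_cons; case: (P j) => //; exact: observableD.
Qed.

End observables.

Section Nint_theory.
Context {R : realType} {T : finType} {N : nat} (J' K' : T -> T -> R).
Implicit Types (f : (T * 'I_N -> R) -> R) (x y : T) (i j k : 'I_N).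
Local Notation I := (@Nint R T N J' K').

Lemma tame_observable f : observable f ->
  tame (enum {: T * 'I_N}) (fun u => f u * Nweight J' K' u).
Proof. by case; exact: tame_weighted. Qed.

Lemma observable_spin x k : observable (fun u : T * 'I_N -> R => spin u x k).
Proof. by split; [exact: comeasurable_spin|exists 1 => u; exact: spin_le1]. Qed.

Lemma observable_sdot x y : observable (fun u : T * 'I_N -> R => sdot u x y).
Proof. by split; [exact: comeasurable_sdot|exists 1 => u; exact: sdot_le1]. Qed.

Lemma NintD f f' : observable f -> observable f' -> I (fun u => f u + f' u) = I f + I f'.
Proof.
move=> of_ of'; rewrite /Nint -fintD; try exact: tame_observable.
by congr fint; apply/funext => u; rewrite mulrDl.
Qed.

Lemma NintZ c f : observable f -> I (fun u => c * f u) = c * I f.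
Proof.
move=> of_; rewrite /Nint -fintZ; last exact: tame_observable.
by congr fint; apply/funext => u; rewrite mulrA.
Qed.

Lemma NintB f f' : observable f -> observable f' -> I (fun u => f u - f' u) = I f - I f'.
Proof.
move=> of_ of'; rewrite -[in RHS]mulN1r -NintZ// -NintD//.
  by congr Nint; apply/funext => u; rewrite mulN1r.
by apply: (observableM (fun=> -1)) => //; exact: observable_cst.
Qed.

Lemma Nint_sum (A : Type) (r : seq A) (P : pred A) (f : A -> (T * 'I_N -> R) -> R) :
  (forall a, observable (f a)) ->
  I (fun u => \sum_(a <- r | P a) f a u) = \sum_(a <- r | P a) I (f a).
Proof.
move=> of_; rewrite /Nint -fint_sum; last by move=> a; exact: tame_observable.
by congr fint; apply/funext => u; rewrite mulr_suml.
Qed.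

Lemma Nint_le f f' : observable f -> observable f' -> (forall u, f u <= f' u) -> I f <= I f'.
Proof.
move=> of_ of' h; apply: fint_le; try exact: tame_observable.
by move=> u; rewrite ler_wpM2r// Nweight_ge0.
Qed.

Lemma Nint_ge0 f : observable f -> (forall u, 0 <= f u) -> 0 <= I f.
Proof.
move=> of_ h; have e : I (fun=> 0) = 0.
  have := NintZ 0 (fun=> 1) (observable_cst 1); by rewrite !mul0r.
by rewrite -e; apply: Nint_le => //; exact: observable_cst.
Qed.

Lemma sum_offdiag (F : 'I_N -> 'I_N -> R) :
  \sum_i \sum_(j | j != i) F i j = \sum_i \sum_j F i j - \sum_i F i i.
Proof.
rewrite -sumrB; apply: eq_bigr => i _.
by rewrite [in RHS](bigD1 i)//= addrAC subrr add0r.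
Qed.

Lemma sum_pairD (a : 'I_N -> R) :
  \sum_i \sum_j (a i + a j) = 2 * N%:R * \sum_i a i.
Proof.
under eq_bigr do rewrite big_split /= sumr_const card_ord -mulr_natl.
by rewrite big_split /= -mulr_sumr sumr_const card_ord -mulr_natl; ring.
Qed.

(** Serves both signs: [e = -1] for the differences of squares and [e = 1] for the plane norms. *)
Lemma sum_pairM (e : R) (a b : 'I_N -> R) :
  \sum_i \sum_j (a i + e * a j) * (b i + e * b j) =
  (1 + e ^+ 2) * N%:R * \sum_i a i * b i + 2 * e * ((\sum_i a i) * (\sum_i b i)).
Proof.
rewrite (eq_bigr (fun i => N%:R * (a i * b i) + e * a i * (\sum_j b j) +
   (e * (\sum_j a j) * b i + e ^+ 2 * \sum_j a j * b j))); last first.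
  move=> i _; rewrite (eq_bigr (fun j => a i * b i + e * a i * b j +
      (e * b i * a j + e ^+ 2 * (a j * b j)))); last by move=> j _; ring.
  by rewrite !big_split /= sumr_const card_ord -mulr_natl -!mulr_sumr; ring.
rewrite !big_split /= -!mulr_sumr -!mulr_suml -mulr_sumr sumr_const card_ord -mulr_natl; ring.
Qed.

(** The same rotation at every site preserves all scalar products, unlike the site-dependent
    rotations used for the comparison. *)
Lemma Nweight_rot i j (c s : R) u : i != j -> c ^+ 2 + s ^+ 2 = 1 ->
  Nweight J' K' (siterot i j (fun=> c) (fun=> s) u) = Nweight J' K' u.
Proof.
move=> ij cs; rewrite /Nweight; congr (expR _ * _); last first.
  by apply: eq_bigr => x _; rewrite siterot_norm.
rewrite /pairsum; apply: eq_bigr => x _; apply: eq_bigr => y _.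
suff -> : sdot (siterot i j (fun=> c) (fun=> s) u) x y = sdot u x y by [].
rewrite !(sdot_plane i j)// rest_dot_siterot//; congr (_ + _).
rewrite /plane_dot !spin_siterot// !siterot_fst !siterot_snd//=.
rewrite -[RHS]mul1r -cs; ring.
Qed.

(* Rotation by pi / 4 in the plane (i, j) exchanges the two components of the
   spin-2 representation. *)
Lemma Nint_plane_rot i j x y : i != j ->
  I (fun u => (spin u x i ^+ 2 - spin u x j ^+ 2) * (spin u y i ^+ 2 - spin u y j ^+ 2)) =
  I (fun u => 4 * (spin u x i * spin u x j * spin u y i * spin u y j)).
Proof.
move=> ij; set f := (X in I X = _).
have of_ : observable f.
  by apply: observableM; apply: observableB; apply: observableX; exact: observable_spin.
pose c : R := Num.sqrt 2^-1.
have c2 : c ^+ 2 = 2^-1 by rewrite sqr_sqrtr// invr_ge0.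
have cc : c ^+ 2 + c ^+ 2 = 1 by rewrite c2; field.
have [_ e0] := @tame_siterot R T N i j (fun=> c) (fun=> c) _ ij (fun=> cc) (tame_observable f of_).
rewrite /Nint -e0.
congr fint; apply/funext => u; rewrite Nweight_rot// /f; congr (_ * _).
rewrite !spin_siterot// !siterot_fst !siterot_snd//=.
set a := spin u x i; set b := spin u x j; set a' := spin u y i; set b' := spin u y j.
(* A rotation by pi / 4 turns the difference of squares into minus twice the product; the two minus
   signs, one per site, cancel. *)
have e p q : (c * p - c * q) ^+ 2 - (c * p + c * q) ^+ 2 = - 2 * (p * q).
  by transitivity (- 4 * c ^+ 2 * (p * q)); [ring|rewrite c2; field].
by rewrite !e; ring.
Qed.

End Nint_theory.

(** * Summing the inequalities over coordinate planes *)

Section integrated_comparison.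
Context {R : realType} {T : finType} {N n : nat} (N2 : (2 <= N)%N).
Context (n_even : ~~ odd n) (J' K' J K : T -> T -> R).
Context (hJ : forall x y : T, x != y ->
     (if `|K' x y| <= `|J' x y| then `|J' x y|
      else 4^-1 * `|K' x y| * (1 + `|J' x y| / `|K' x y|) ^+ 2) <= J x y)
  (hK : forall x y : T, x != y -> 4^-1 * `|K' x y| <= K x y).
Implicit Types (x y : T) (i j k : 'I_N).
Local Notation I := (@Nint R T N J' K').

Let N1 : 0 < N%:R - 1 :> R. Proof. by rewrite subr_gt0 ltr1n. Qed.

Lemma observable_plane_dot i j x y : observable (fun u : T * 'I_N -> R => plane_dot i j u x y).
Proof. by apply: observableD; apply: observableM; exact: observable_spin. Qed.

Lemma observable_plane_norm2 i j x : observable (fun u : T * 'I_N -> R => plane_norm2 i j u x).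
Proof. by apply: observableD; apply: observableX; exact: observable_spin. Qed.

Lemma observable_plane_dot2 i j x y : observable (fun u : T * 'I_N -> R => plane_dot2 i j u x y).
Proof.
apply: observableD.
  by apply: observableM; apply: observableB; apply: observableX; exact: observable_spin.
apply: observableM; first exact: observable_cst.
by apply: observableM; [apply: observableM; [apply: observableM|]|]; exact: observable_spin.
Qed.

Lemma Nint_sdot_clock x y :
  clock_Z n J K * `|I (fun u => sdot u x y)| <= clock_cos n J K 1 x y * I (fun=> 1).
Proof.
(* Both signs are proved at once; together they bound the absolute value. *)
have key (b : bool) : clock_Z n J K * ((-1) ^+ b * I (fun u => sdot u x y)) <=
    clock_cos n J K 1 x y * I (fun=> 1).
  have h i j : i != j ->
      clock_Z n J K * I (fun u => (-1) ^+ b * plane_dot i j u x y) <=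
      clock_cos n J K 1 x y * I (fun u => (plane_norm2 i j u x + plane_norm2 i j u y) / 2).
    move=> ij; apply: (@fint_grid_average R T N n i j) => //.
    - apply: tame_observable; apply: observableM; first exact: observable_cst.
      exact: observable_plane_dot.
    - apply: tame_observable; apply: observableM; last exact: observable_cst.
      by apply: observableD; exact: observable_plane_norm2.
    - move=> u; exact: (grid_plane_dot_le n_even J' K' J K hJ hK).
  have : \sum_i \sum_(j | j != i) clock_Z n J K * I (fun u => (-1) ^+ b * plane_dot i j u x y)
     <= \sum_i \sum_(j | j != i) clock_cos n J K 1 x y *
       I (fun u => (plane_norm2 i j u x + plane_norm2 i j u y) / 2).
    by apply: ler_sum => i _; apply: ler_sum => j ji; apply: h; rewrite eq_sym.
  under eq_bigr do rewrite -mulr_sumr.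
  rewrite -mulr_sumr.
  under [X in _ <= X -> _]eq_bigr do rewrite -mulr_sumr.
  rewrite -mulr_sumr.
  have o1 i j : observable (fun u : T * 'I_N -> R => (-1) ^+ b * plane_dot i j u x y).
    by apply: observableM; [exact: observable_cst|exact: observable_plane_dot].
  have o2 i j : observable (fun u : T * 'I_N -> R => (plane_norm2 i j u x + plane_norm2 i j u y) / 2).
    apply: observableM; last exact: observable_cst.
    by apply: observableD; exact: observable_plane_norm2.
  (* Each coordinate lies in 2 (N - 1) ordered planes. The same factor appears on the right and
     cancels. *)
  have -> : \sum_i \sum_(j | j != i) I (fun u => (-1) ^+ b * plane_dot i j u x y) =
      2 * (N%:R - 1) * ((-1) ^+ b * I (fun u => sdot u x y)).
    under eq_bigr do rewrite -Nint_sum//.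
    rewrite -Nint_sum; last by move=> i; apply: observable_sum.
    rewrite mulrA -NintZ; last exact: observable_sdot.
    congr Nint; apply/funext => u.
    rewrite (sum_offdiag (fun i j => (-1) ^+ b * plane_dot i j u x y)).
    under eq_bigr do rewrite -mulr_sumr.
    rewrite -!mulr_sumr (sum_pairD (fun i => spin u x i * spin u y i)).
    by rewrite /plane_dot big_split /= /sdot; ring.
  move=> hh.
  suff : \sum_i \sum_(j | j != i) I (fun u => (plane_norm2 i j u x + plane_norm2 i j u y) / 2)
      <= 2 * (N%:R - 1) * I (fun=> 1).
    move=> /(ler_wpM2l (clock_cos1_ge0 n_even J' K' J K hJ hK x y)) /(le_trans hh).
    by rewrite !(mulrCA _ (2 * (N%:R - 1))) ler_pM2l// mulr_gt0.
  under eq_bigr do rewrite -Nint_sum//.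
  rewrite -Nint_sum; last by move=> i; apply: observable_sum.
  rewrite -NintZ; last exact: observable_cst.
  apply: Nint_le.
  - by apply: observable_sum => i; apply: observable_sum.
  - by apply: observableM; exact: observable_cst.
  move=> u; rewrite mulr1 (sum_offdiag (fun i j => (plane_norm2 i j u x + plane_norm2 i j u y) / 2)).
  pose a i := (spin u x i ^+ 2 + spin u y i ^+ 2) / 2.
  rewrite (eq_bigr (fun i => \sum_j (a i + a j))); last first.
    by move=> i _; apply: eq_bigr => j _; rewrite /a /plane_norm2; field.
  rewrite sum_pairD [X in _ - X](eq_bigr (fun i => 2 * a i)); last first.
    by move=> i _; rewrite /a /plane_norm2; field.
  have a1 : \sum_i a i <= 1.
    rewrite -mulr_suml big_split /=.
    have := spin_norm_le1 u x; have := spin_norm_le1 u y; lra.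
  rewrite -mulr_sumr; have := ler_wpM2l (ltW N1) a1; lra.
have h1 := key false; have h2 := key true.
rewrite expr0 mul1r in h1; rewrite expr1 mulN1r in h2.
by case: ger0P.
Qed.

Lemma Nint_sdot2_clock x y :
  I (fun u => sdot u x y ^+ 2) *
    (2 * N%:R * clock_Z n J K - (N%:R - 2) * clock_cos n J K 2 x y) <=
  I (fun=> 1) * (2 * clock_Z n J K + N%:R * clock_cos n J K 2 x y).
Proof.
(* The fourth-order moments involved: [p] and [q] are invariant under a common rotation, [s] is not.
   Away from zero vectors [p] is 1, but only [p <= 1] is used. *)
pose s (u : T * 'I_N -> R) := \sum_i spin u x i ^+ 2 * spin u y i ^+ 2.
pose p (u : T * 'I_N -> R) := (\sum_i spin u x i ^+ 2) * (\sum_i spin u y i ^+ 2).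
pose q (u : T * 'I_N -> R) := sdot u x y ^+ 2.
have o2 x0 i : observable (fun u : T * 'I_N -> R => spin u x0 i ^+ 2).
  by apply: observableX; exact: observable_spin.
have os : observable s by apply: observable_sum => i; apply: observableM.
have op : observable p by apply: observableM; apply: observable_sum.
have oq : observable q by apply: observableX; exact: observable_sdot.
have oc i j : observable (fun u : T * 'I_N -> R =>
    4 * (spin u x i * spin u x j * spin u y i * spin u y j)).
  apply: observableM; first exact: observable_cst.
  by apply: observableM; [apply: observableM; [apply: observableM|]|]; exact: observable_spin.
have od i j : observable (fun u : T * 'I_N -> R =>
    (spin u x i ^+ 2 - spin u x j ^+ 2) * (spin u y i ^+ 2 - spin u y j ^+ 2)).
  by apply: observableM; apply: observableB.
have on i j : observable (fun u : T * 'I_N -> R => plane_norm2 i j u x * plane_norm2 i j u y).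
  by apply: observableM; exact: observable_plane_norm2.
have sumI (f : 'I_N -> 'I_N -> (T * 'I_N -> R) -> R) : (forall i j, observable (f i j)) ->
    \sum_i \sum_(j | j != i) I (f i j) = I (fun u => \sum_i \sum_(j | j != i) f i j u).
  move=> of_; rewrite Nint_sum; last by move=> i; apply: observable_sum.
  by apply: eq_bigr => i _; rewrite Nint_sum.
have offd u : \sum_i \sum_(j | j != i) 4 * (spin u x i * spin u x j * spin u y i * spin u y j)
    = 4 * (q u - s u).
  rewrite (sum_offdiag (fun i j => 4 * (spin u x i * spin u x j * spin u y i * spin u y j))).
  rewrite (eq_bigr (fun i => 4 * (spin u x i * spin u y i) * sdot u x y)); last first.
    by move=> i _; rewrite /sdot mulr_sumr; apply: eq_bigr => j _; ring.
  rewrite -mulr_suml -mulr_sumr [X in _ - X](eq_bigr (fun i =>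
      4 * (spin u x i ^+ 2 * spin u y i ^+ 2))); last by move=> i _; ring.
  by rewrite -mulr_sumr -/(s u) -/(sdot u x y) /q; ring.
have offp u : \sum_i \sum_(j | j != i) (spin u x i ^+ 2 - spin u x j ^+ 2) *
    (spin u y i ^+ 2 - spin u y j ^+ 2) = 2 * N%:R * s u - 2 * p u.
  rewrite (sum_offdiag (fun i j =>
       (spin u x i ^+ 2 - spin u x j ^+ 2) * (spin u y i ^+ 2 - spin u y j ^+ 2))).
  rewrite [X in _ - X]big1 ?subr0; last by move=> i _; rewrite subrr mul0r.
  have := sum_pairM (-1) (fun i => spin u x i ^+ 2) (fun i => spin u y i ^+ 2).
  under eq_bigr do under eq_bigr do rewrite !mulN1r.
  by move=> ->; rewrite -/(s u) -/(p u); ring.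
have E1 : I (fun u => 2 * N%:R * s u - 2 * p u) = I (fun u => 4 * (q u - s u)).
  have : \sum_i \sum_(j | j != i) I (fun u =>
       (spin u x i ^+ 2 - spin u x j ^+ 2) * (spin u y i ^+ 2 - spin u y j ^+ 2)) =
     \sum_i \sum_(j | j != i) I (fun u =>
       4 * (spin u x i * spin u x j * spin u y i * spin u y j)).
    by apply: eq_bigr => i _; apply: eq_bigr => j ji; apply: Nint_plane_rot; rewrite eq_sym.
  rewrite !sumI// => e.
  transitivity (I (fun u => \sum_i \sum_(j | j != i)
       (spin u x i ^+ 2 - spin u x j ^+ 2) * (spin u y i ^+ 2 - spin u y j ^+ 2))).
    by congr Nint; apply/funext => u; rewrite offp.
  by rewrite e; congr Nint; apply/funext => u; rewrite offd.
(* Isotropy expresses the non-invariant moment [s] through the invariant ones. *)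
have S_E : (N%:R + 2) * I s = I p + 2 * I q.
  move: E1; rewrite NintB ?NintZ// ?NintB//; first by lra.
  - exact: observableB.
  - by apply: observableM => //; exact: observable_cst.
  - by apply: observableM => //; exact: observable_cst.
(* The two halves of [plane_dot2] have equal integrals by [E1], hence 8, twice the 4 of [offd]. *)
have E2 : \sum_i \sum_(j | j != i) I (fun u => plane_dot2 i j u x y) = 8 * (I q - I s).
  rewrite sumI; last by move=> i j; exact: observable_plane_dot2.
  transitivity (I (fun u => (2 * N%:R * s u - 2 * p u) + 4 * (q u - s u))).
    congr Nint; apply/funext => u; rewrite -offd -offp -big_split.
    by apply: eq_bigr => i _; rewrite -big_split.
  have o4 : observable (fun u => 4 * (q u - s u)).
    by apply: observableM; [exact: observable_cst|exact: observableB].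
  rewrite NintD//; last first.
    by apply: observableB; apply: observableM => //; exact: observable_cst.
  rewrite E1 NintZ ?NintB//; [by ring|exact: observableB].
have E3 : \sum_i \sum_(j | j != i) I (fun u => plane_norm2 i j u x * plane_norm2 i j u y) =
   2 * (N%:R - 2) * I s + 2 * I p.
  rewrite sumI//; transitivity (I (fun u => 2 * (N%:R - 2) * s u + 2 * p u)).
    congr Nint; apply/funext => u; rewrite (sum_offdiag (fun i j =>
       plane_norm2 i j u x * plane_norm2 i j u y)).
    have := sum_pairM 1 (fun i => spin u x i ^+ 2) (fun i => spin u y i ^+ 2).
    under eq_bigr do under eq_bigr do rewrite !mul1r.
    move=> ->; rewrite -/(s u) -/(p u) [X in _ - X](eq_bigr (fun i =>
      4 * (spin u x i ^+ 2 * spin u y i ^+ 2))); last by move=> i _; rewrite /plane_norm2; ring.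
    by rewrite -mulr_sumr -/(s u); ring.
  by rewrite NintD ?NintZ//; apply: observableM => //; exact: observable_cst.
have main : clock_Z n J K * (8 * (I q - I s)) <=
    clock_cos n J K 2 x y * (2 * (N%:R - 2) * I s + 2 * I p).
  rewrite -E2 -E3 !mulr_sumr; apply: ler_sum => i _.
  rewrite !mulr_sumr; apply: ler_sum => j ji.
  have ij : i != j by rewrite eq_sym.
  apply: (@fint_grid_average R T N n i j) => //.
  - by apply: tame_observable; exact: observable_plane_dot2.
  - exact: tame_observable.
  - by move=> u; exact: (grid_plane_dot2_le n_even J' K' J K hJ hK).
have p1 : I p <= I (fun=> 1).
  apply: Nint_le => //; first exact: observable_cst.
  move=> u; rewrite /p mulr_ile1 ?spin_norm_le1//; apply: sumr_ge0 => i _; exact: sqr_ge0.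
have Z0 := clock_Z_gt0 (n := n) J K.
have C0 := clock_cos2_ge0 n_even J' K' J K hJ hK x y.
set Z := clock_Z n J K in main Z0 *; set C := clock_cos n J K 2 x y in main C0 *.
have NN : 0 < N%:R + 2 :> R by have := N1; lra.
(* Multiplying [main] by N + 2 allows [S_E] to eliminate [s]; what remains is four times this
   inequality. *)
have : I q * (2 * N%:R * Z - (N%:R - 2) * C) <= I p * (2 * Z + N%:R * C).
  have := ler_wpM2l (ltW NN) main.
  have -> : (N%:R + 2) * (Z * (8 * (I q - I s))) = Z * (8 * ((N%:R + 2) * I q - (N%:R + 2) * I s)).
    by ring.
  have -> : (N%:R + 2) * (C * (2 * (N%:R - 2) * I s + 2 * I p)) =
     C * (2 * (N%:R - 2) * ((N%:R + 2) * I s) + 2 * (N%:R + 2) * I p) by ring.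
  rewrite S_E; lra.
move/le_trans; apply; apply: ler_wpM2r => //.
by rewrite addr_ge0// mulr_ge0// ltW.
Qed.

End integrated_comparison.

(** * Riemann sums on the torus *)

Section riemann.
Context {R : realType}.
Local Open Scope classical_set_scope.
Local Open Scope ring_scope.
Local Notation mu := (@lebesgue_measure R).
Implicit Types (f : R -> R) (C a b : R).

Definition lip1 C f := forall t t', `|f t - f t'| <= C * `|t - t'|.

Lemma lip1_ge0 C f : lip1 C f -> 0 <= C.
Proof. by move=> /(_ 1 0); rewrite subr0 normr1 mulr1; exact: le_trans. Qed.

Lemma lip1_continuous C f : lip1 C f -> continuous f.
Proof.
move=> fC t; apply/cvgrPdist_le => e e0.
have C0 := lip1_ge0 _ _ fC; have C1 : 0 < C + 1 by rewrite ltr_wpDl.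
near=> s; apply: (le_trans (fC t s)).
apply: (@le_trans _ _ ((C + 1) * `|t - s|)); first by rewrite ler_wpM2r// lerDl.
rewrite mulrC -ler_pdivlMr//; near: s.
by apply: cvgr_dist_le; [exact: cvg_id|rewrite divr_gt0].
Unshelve. all: by end_near. Qed.

Lemma lip1_integrable C f a b : lip1 C f -> mu.-integrable `[a, b] (EFin \o f).
Proof.
move=> fC; apply: continuous_compact_integrable; first exact: segment_compact.
by apply: continuous_subspaceT; exact: lip1_continuous fC.
Qed.

(** The cell is open on the left because it is what remains when [0, h m] is removed from
    [0, h m + h]. On it [f] differs from [f a] by at most [C * h]. *)
Lemma lip1_cell C f a h : lip1 C f -> 0 <= h ->
  `|Rintegral mu `]a, (a + h)] f - h * f a| <= C * h ^+ 2.
Proof.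
move=> fC h0; have C0 := lip1_ge0 _ _ fC.
have fi : mu.-integrable `]a, (a + h)] (EFin \o f).
  by apply: (integrableS _ _ _ (lip1_integrable C f a (a + h) fC)) => //; apply: subset_itvr; rewrite bnd_simp.
have ci (c : R) : mu.-integrable `]a, (a + h)] (EFin \o (fun=> c)).
  have c0 : lip1 0 (fun=> c) by move=> t t'; rewrite subrr normr0 mul0r.
  by apply: (integrableS _ _ _ (lip1_integrable _ _ a (a + h) c0)) => //; apply: subset_itvr; rewrite bnd_simp.
have cE (c : R) : Rintegral mu `]a, (a + h)] (fun=> c) = c * h.
  rewrite Rintegral_cst//= lebesgue_measure_itv/= lte_fin ltrDl.
  case: (ltP 0 h) => h1 /=; first by rewrite addrAC subrr add0r.
  by rewrite (le_anti (introT andP (conj h0 h1))).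
have hd t : a < t <= a + h -> `|f t - f a| <= C * h.
  move=> /andP[at_ th]; apply: (le_trans (fC t a)); rewrite ler_wpM2l//.
  by rewrite gtr0_norm ?subr_gt0// lerBlDl.
rewrite ler_norml; apply/andP; split.
- suff : (f a - C * h) * h <= Rintegral mu `]a, (a + h)] f by rewrite expr2; lra.
  rewrite -cE; apply: le_Rintegral => // t; rewrite /= in_itv /= => /hd.
  by rewrite ler_norml; lra.
- suff : Rintegral mu `]a, (a + h)] f <= (f a + C * h) * h by rewrite expr2; lra.
  rewrite -cE; apply: le_Rintegral => // t; rewrite /= in_itv /= => /hd.
  by rewrite ler_norml; lra.
Qed.

Lemma lip1_riemann C f h m : lip1 C f -> 0 <= h ->
  `|Rintegral mu `[0, (h * m%:R)] f - \sum_(k < m) h * f (h * k%:R)|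
    <= C * h ^+ 2 * m%:R.
Proof.
move=> fC h0; elim: m => [|m IH].
  by rewrite big_ord0 mulr0 set_itv1 Rintegral_set1 subr0 normr0 mulr0.
have := @Rintegral_itvB R f (BLeft 0) (BRight (h * m%:R + h)) (h * m%:R)
  (lip1_integrable C f _ _ fC).
rewrite !bnd_simp mulr_ge0// lerDl h0 => /(_ isT isT) e.
have c := lip1_cell C f (h * m%:R) h fC h0; rewrite -e in c.
rewrite big_ord_recr /= -natr1 !mulrDr !mulr1.
set I1 := Rintegral _ _ _ in c *; set I0 := Rintegral _ _ _ in c IH.
set S := \sum_(k < m) _ in IH *; set d := h * f _ in c *.
rewrite (_ : I1 - (S + d) = (I0 - S) + (I1 - I0 - d)); last by ring.
by apply: (le_trans (ler_normD _ _)); exact: lerD.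
Qed.

End riemann.

(** * Riemann sums in several variables *)

Definition lip {R : realType} {I : eqType} (C : R) (F : (I -> R) -> R) :=
  forall v i, lip1 C (fun t => F (update v i t)).

(** Left-endpoint Riemann sums, nested like [iterint] so that the errors can be compared by
    induction. *)
Fixpoint grid_sum {R : realType} {I : eqType} (n : nat) (s : seq I)
    (F : (I -> R) -> R) (v : I -> R) : R :=
  match s with
  | [::] => F v
  | i :: s' => \sum_(k < n.+1) (2 * pi / n.+1%:R) *
      grid_sum n s' F (update v i (2 * pi / n.+1%:R * k%:R))
  end.

Section multi_riemann.
Context {R : realType} {I : eqType}.
Local Open Scope classical_set_scope.
Local Open Scope ring_scope.
Local Notation mu := (@lebesgue_measure R).
Local Notation D := [set t : R | 0 <= t <= 2 * pi].
Implicit Types (F : (I -> R) -> R) (C : R) (s : seq I).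

Lemma circleE : D = `[0, 2 * pi]%classic.
Proof. by apply/seteqP; split => t /=; rewrite in_itv. Qed.

Lemma circle_cst (c : R) : Rintegral mu D (fun=> c) = c * (2 * pi).
Proof.
have p0 : 0 < 2 * pi :> R by rewrite mulr_gt0// pi_gt0.
by rewrite circleE Rintegral_cst//= lebesgue_measure_itv/= lte_fin p0 /= subr0.
Qed.

Lemma lip_int C F i : lip C F ->
  lip (2 * pi * C) (fun v => Rintegral mu D (fun t => F (update v i t))).
Proof.
move=> FC v k t t'.
have C0 : 0 <= C := lip1_ge0 _ _ (FC v i).
have p0 : 0 <= 2 * pi :> R by rewrite mulr_ge0// pi_ge0.
have [ki|ki] := eqVneq k i.
  rewrite ki; under [X in X - _]eq_Rintegral do rewrite update_same.
  under [X in _ - X]eq_Rintegral do rewrite update_same.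
  by rewrite subrr normr0 mulr_ge0// mulr_ge0.
rewrite circleE -RintegralB//; try exact: (lip1_integrable _ _ _ _ (FC _ _)).
(* Needed only for the integrability of the difference; the sharp bound in [t - t'] comes
   afterwards, pointwise. *)
have lB : lip1 (2 * C) (fun r => F (update (update v k t) i r) - F (update (update v k t') i r)).
  move=> r r'; have := FC (update v k t) i r r'; have := FC (update v k t') i r r'.
  set a := F _; set b := F _; set c := F _; set d := F _ => h1 h2.
  rewrite (_ : c - a - (d - b) = (c - d) - (a - b)); last by ring.
  by apply: (le_trans (ler_normB _ _)); lra.
have bi := lip1_integrable _ _ 0 (2 * pi) lB.
apply: (le_trans (le_normr_Rintegral _ bi)) => //.
have cl : lip1 0 (fun=> C * `|t - t'| : R) by move=> r r'; rewrite subrr normr0 mul0r.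
apply: (le_trans (le_Rintegral _ (integrable_norm bi) (lip1_integrable _ _ 0 (2 * pi) cl) _)) => //.
  by move=> r _; rewrite /= !(update_swap _ k i)//; exact: FC.
by rewrite -circleE circle_cst; rewrite le_eqVlt; apply/predU1l; ring.
Qed.

Lemma lip_iterint s C F : lip C F -> exists C', lip C' (iterint D s F).
Proof.
move=> FC; elim: s => [|i s [C' IH]]; first by exists C.
by exists (2 * pi * C'); apply: lip_int.
Qed.

Lemma iterint_grid_sum s C F : lip C F -> exists c, 0 <= c /\
  forall n v, `|iterint D s F v - grid_sum n s F v| <= c / n.+1%:R.
Proof.
move=> FC; elim: s => [|i s [c [c0 IH]]].
  by exists 0; split=> // n v; rewrite subrr normr0 mul0r.
have [C' sC] := lip_iterint s C F FC.
have C0 : 0 <= C' := lip1_ge0 _ _ (sC (fun=> 0) i).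
have p0 : 0 <= 2 * pi :> R by rewrite mulr_ge0// pi_ge0.
(* The first term is the error of the outer Riemann sum, [n.+1] cells with [C' * h ^+ 2] each; the
   second is the inner error summed against weights of total mass 2 pi. *)
exists (C' * (2 * pi) ^+ 2 + 2 * pi * c); split.
  by rewrite addr_ge0// mulr_ge0// sqr_ge0.
move=> n v /=; set h := 2 * pi / n.+1%:R.
have n0 : n.+1%:R != 0 :> R by rewrite pnatr_eq0.
have hn : h * n.+1%:R = 2 * pi by rewrite mulfVK.
have h0 : 0 <= h by rewrite divr_ge0.
have := lip1_riemann _ _ h n.+1 (sC v i) h0; rewrite hn -circleE => r.
set A := Rintegral _ _ _ in r *; set S := \sum_(k < n.+1) _ in r *.
set S' := \sum_(k < n.+1) _.
rewrite (_ : A - S' = (A - S) + (S - S')); last by ring.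
apply: (le_trans (ler_normD _ _)); rewrite mulrDl; apply: lerD.
  by apply: (le_trans r); rewrite le_eqVlt; apply/predU1l; rewrite /h; field.
rewrite /S /S' -sumrB; apply: (le_trans (ler_norm_sum _ _ _)).
apply: (@le_trans _ _ (\sum_(k < n.+1) h * (c / n.+1%:R))).
  by apply: ler_sum => k _; rewrite -mulrBr normrM (ger0_norm h0) ler_wpM2l.
by rewrite sumr_const card_ord -mulr_natl; rewrite le_eqVlt; apply/predU1l; rewrite /h; field.
Qed.

End multi_riemann.

Section torus.
Context {R : realType} {T : finType}.
Local Open Scope classical_set_scope.
Local Open Scope ring_scope.
Local Notation D := [set t : R | 0 <= t <= 2 * pi].
Implicit Types (F : (T -> R) -> R) (s : seq T).

Definition grid_mix (n : nat) s (v : T -> R) (g : {ffun T -> 'I_n.+1}) : T -> R :=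
  fun x => if x \in s then clock_angle g x else v x.

(** As [Phi k] ignores [g i], translating [g] by [e k] shows that every shifted sum, with [g i + k]
    in place of [g i], has the same value; summing over [k] covers all first arguments. *)
Lemma sum_freeze (n : nat) (i : T) (Phi : 'I_n.+1 -> {ffun T -> 'I_n.+1} -> R) :
  (forall k (g g' : {ffun T -> 'I_n.+1}), (forall x, x != i -> g x = g' x) -> Phi k g = Phi k g') ->
  \sum_k \sum_(g : {ffun T -> 'I_n.+1}) Phi k g = n.+1%:R * \sum_(g : {ffun T -> 'I_n.+1}) Phi (g i) g.
Proof.
move=> hP.
pose e (k : 'I_n.+1) : {ffun T -> 'I_n.+1} := [ffun x => if x == i then k else 0].
have sh (k : 'I_n.+1) : \sum_(g : {ffun T -> 'I_n.+1}) Phi (g i) g = \sum_(g : {ffun T -> 'I_n.+1}) Phi (g i + k) g.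
  rewrite (reindex_inj (addIr (e k))) /=; apply: eq_bigr => g _.
  rewrite !ffunE eqxx; apply: hP => x xi.
  by rewrite !ffunE (negbTE xi) addr0.
transitivity (\sum_(k < n.+1) \sum_(g : {ffun T -> 'I_n.+1}) Phi (g i + k) g).
  rewrite exchange_big [RHS]exchange_big /=; apply: eq_bigr => g _.
  by rewrite (reindex_inj (addrI (g i))).
under eq_bigr do rewrite -sh.
by rewrite sumr_const card_ord mulr_natl.
Qed.

(** On the right all sites range over the grid, and each site outside [s] merely multiplies the sum
    by [n.+1]. This explains the exponent [#|T|] instead of [size s]. *)
Lemma grid_sumE (n : nat) s F v : uniq s ->
  n.+1%:R ^+ #|T| * grid_sum n s F v =
  (2 * pi) ^+ size s * \sum_(g : {ffun T -> 'I_n.+1}) F (grid_mix n s v g).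
Proof.
elim: s v => [|i s IH] v /=.
  by move=> _; rewrite mul1r (eq_bigr (fun=> F v))// sumr_const card_ffun card_ord -[in RHS]mulr_natl natrX.
move=> /andP[is_ us]; rewrite [LHS]mulr_sumr.
under [LHS]eq_bigr do rewrite mulrCA IH//.
rewrite -mulr_sumr -[X in _ * X]mulr_sumr.
rewrite (sum_freeze n i (fun k g => F (grid_mix n s (update v i (2 * pi / n.+1%:R * k%:R)) g))).
  rewrite exprS; set S := \sum_g _; set S' := \sum_g _.
  rewrite (_ : S = S'); first by field.
  apply: eq_bigr => g _; congr F; apply/funext => x; rewrite /grid_mix inE updateE.
  by case: (eqVneq x i) => [->|//] /=; rewrite (negbTE is_).
move=> k g g' gg'; congr F; apply/funext => x; rewrite /grid_mix.
case: ifP => // xs; rewrite /clock_angle gg'//.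
by apply: contraTneq xs => ->.
Qed.

Lemma fint_grid C F : lip C F -> exists c, 0 <= c /\ forall n : nat,
  `|fint D F - (2 * pi) ^+ #|T| / n.+1%:R ^+ #|T| *
     \sum_(g : {ffun T -> 'I_n.+1}) F (clock_angle g)| <= c / n.+1%:R.
Proof.
move=> FC; have [c [c0 H]] := iterint_grid_sum (enum T) C F FC.
exists c; split=> // n; have := H n (fun=> 0).
have := grid_sumE n (enum T) F (fun=> 0) (enum_uniq _); rewrite -cardE => e.
have n0 : n.+1%:R ^+ #|T| != 0 :> R by rewrite expf_neq0// pnatr_eq0.
rewrite /fint; congr (`|_ - _| <= _).
apply: (mulfI n0); rewrite e mulrA (mulrC _ (_ / _)) divfK//; congr (_ * _).
apply: eq_bigr => g _; congr F; apply/funext => x.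
by rewrite /grid_mix mem_enum.
Qed.

End torus.

(** * The limit of the clock models *)

Section bounded_lipschitz.
Context {R : realType} {I : eqType}.
Implicit Types F : (I -> R) -> R.

Definition bounded_lip F := (exists M, forall v, `|F v| <= M) /\ exists C, lip C F.

Lemma bounded_lip_cst (c : R) : bounded_lip (fun=> c).
Proof.
split; first by exists `|c|.
by exists 0 => v i t t'; rewrite subrr normr0 mul0r.
Qed.

Lemma bounded_lipD F F' : bounded_lip F -> bounded_lip F' -> bounded_lip (fun v => F v + F' v).
Proof.
move=> [[M bF] [C lF]] [[M' bF'] [C' lF']]; split.
  by exists (M + M') => v; apply: (le_trans (ler_normD _ _)); exact: lerD.
exists (C + C') => v i t t'; rewrite opprD addrACA mulrDl.
by apply: (le_trans (ler_normD _ _)); exact: lerD (lF _ _ _ _) (lF' _ _ _ _).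
Qed.

Lemma bounded_lipM F F' : bounded_lip F -> bounded_lip F' -> bounded_lip (fun v => F v * F' v).
Proof.
move=> [[M bF] [C lF]] [[M' bF'] [C' lF']]; split.
  by exists (M * M') => v; rewrite normrM ler_pM.
exists (C * M' + M * C') => v i t t'.
set a := F _; set a' := F' _; set b := F (update v i t'); set b' := F' (update v i t').
rewrite (_ : a * a' - b * b' = (a - b) * a' + b * (a' - b')); last by ring.
apply: (le_trans (ler_normD _ _)); rewrite !normrM.
have h1 : `|a - b| * `|a'| <= C * `|t - t'| * M' by apply: ler_pM => //; [exact: (lF v i t t')|exact: bF'].
have h2 : `|b| * `|a' - b'| <= M * (C' * `|t - t'|) by apply: ler_pM => //; [exact: bF|exact: (lF' v i t t')].
by apply: (le_trans (lerD h1 h2)); rewrite le_eqVlt; apply/predU1l; ring.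
Qed.

Lemma bounded_lip_sum (J : Type) (r : seq J) (P : pred J) (F : J -> (I -> R) -> R) :
  (forall j, bounded_lip (F j)) -> bounded_lip (fun v => \sum_(j <- r | P j) F j v).
Proof.
move=> bF; elim: r => [|j r IH].
  by under eq_fun do rewrite big_nil; exact: bounded_lip_cst.
by under eq_fun do rewrite big_cons; case: (P j) => //; exact: bounded_lipD.
Qed.

Lemma expR_lip (M a b : R) : a <= M -> b <= M ->
  `|expR a - expR b| <= expR M * `|a - b|.
Proof.
wlog ab : a b / b <= a => [W|] aM bM.
  by have [/W|/ltW/W] := leP b a; [|rewrite distrC (distrC a)]; apply.
rewrite !ger0_norm ?subr_ge0 ?ler_expR//.
apply: (@le_trans _ _ (expR a * (a - b))); last first.
  by rewrite ler_wpM2r ?subr_ge0// ler_expR.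
(* It remains to bound 1 - exp (b - a) by a - b, which is 1 + t <= exp t. *)
have e : expR b = expR a * expR (b - a) by rewrite -expRD; congr expR; ring.
rewrite e; have := expR_ge1Dx (b - a); have := expR_gt0 a; nra.
Qed.

Lemma bounded_lip_exp F : bounded_lip F -> bounded_lip (fun v => expR (F v)).
Proof.
move=> [[M bF] [C lF]]; have FM v : F v <= M by apply: le_trans (bF v); exact: ler_norm.
split; first by exists (expR M) => v; rewrite ger0_norm ?expR_ge0// ler_expR.
exists (expR M * C) => v i t t'; apply: (le_trans (expR_lip M _ _ (FM _) (FM _))).
by rewrite -mulrA ler_wpM2l ?expR_ge0//; exact: lF.
Qed.

Lemma cos_lip (a b : R) : `|cos a - cos b| <= `|a - b|.
Proof.
wlog ab : a b / b <= a => [W|].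
  by have [/W|/ltW/W] := leP b a; [|rewrite distrC (distrC a)]; apply.
have [c _ ->] := @MVT_segment R cos (fun x => - sin x) b a ab
  (fun x _ => is_derive_cos x) (continuous_subspaceT (@continuous_cos R)).
by rewrite normrM normrN ler_piMl// sin_max.
Qed.

Lemma bounded_lip_cos (m : R) x y : bounded_lip (fun v : I -> R => cos (m * (v x - v y))).
Proof.
split; first by exists 1 => v; exact: cos_max.
exists (`|m| * 2) => v i t t'; apply: (le_trans (cos_lip _ _)).
rewrite -mulrBr normrM -mulrA ler_wpM2l// !updateE.
have d (b : bool) (w : R) : `|(if b then t else w) - (if b then t' else w)| <= `|t - t'|.
  by case: b => //; rewrite subrr normr0.
set p := (if x == i then t else v x); set q := (if y == i then t else v y).
set p' := (if x == i then t' else v x); set q' := (if y == i then t' else v y).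
rewrite (_ : p - q - (p' - q') = (p - p') - (q - q')); last by ring.
apply: (le_trans (ler_normB _ _)).
by have := d (x == i) (v x); have := d (y == i) (v y); rewrite -/p -/q -/p' -/q'; lra.
Qed.

End bounded_lipschitz.

Section XY_limit.
Context {R : realType} {T : finType} (J K : T -> T -> R).
Local Open Scope classical_set_scope.
Local Open Scope ring_scope.
Local Notation D := [set t : R | 0 <= t <= 2 * pi].

Definition XY_Z : R := fint D (XYweight J K).
Definition XY_cos (m : R) (x y : T) : R :=
  fint D (fun th => cos (m * (th x - th y)) * XYweight J K th).

Lemma bounded_lip_XYweight : bounded_lip (XYweight J K).
Proof.
apply: bounded_lip_exp; rewrite /pairsum.
apply: bounded_lip_sum => x; apply: bounded_lip_sum => y.
apply: bounded_lipD; apply: bounded_lipM; do ?exact: bounded_lip_cst.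
  by under eq_fun do rewrite -[_ - _]mul1r; exact: bounded_lip_cos.
exact: bounded_lip_cos.
Qed.

Lemma XYweight_clock n (g : {ffun T -> 'I_n.+1}) :
  XYweight J K (clock_angle g) = expR (clock_energy J K zero_phase g).
Proof.
congr expR; rewrite /clock_energy /pairsum; apply: eq_bigr => x _.
by apply: eq_bigr => y _; rewrite /zero_phase addr0.
Qed.

Definition grid_vol (n : nat) : R := (2 * pi) ^+ #|T| / n.+1%:R ^+ #|T|.

(** Convergence with an explicit rate, so that limits of inequalities reduce to the Archimedean
    property. *)
Definition approximates (p : nat -> R) (P : R) := exists c, 0 <= c /\
  forall n : nat, `|P - grid_vol n * p n| <= c / n.+1%:R.

Lemma clock_Z_approximates : approximates (fun n => clock_Z n J K) XY_Z.
Proof.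
have [_ [C lF]] := bounded_lip_XYweight.
have [c [c0 H]] := fint_grid C _ lF; exists c; split=> // n; have := H n.
by under eq_bigr do rewrite XYweight_clock.
Qed.

Lemma clock_cos_approximates m x y :
  approximates (fun n => clock_cos n J K m x y) (XY_cos m x y).
Proof.
have [_ [C lF]] := bounded_lipM _ _ (bounded_lip_cos m x y) bounded_lip_XYweight.
have [c [c0 H]] := fint_grid C _ lF; exists c; split=> // n; have := H n.
by under eq_bigr do rewrite XYweight_clock.
Qed.

Lemma grid_vol_gt0 n : 0 < grid_vol n.
Proof. by rewrite divr_gt0// exprn_gt0// mulr_gt0// pi_gt0. Qed.

Lemma le0_even_archimedean (a c : R) :
  (forall n : nat, ~~ odd n -> a <= c / n.+1%:R) -> a <= 0.
Proof.
move=> h; rewrite leNgt; apply/negP => a0.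
(* The bound is doubled to obtain an even index. *)
have := h (Num.bound (`|c| / a)).*2; rewrite odd_double => /(_ isT).
have := archi_boundP (divr_ge0 (normr_ge0 c) (ltW a0)).
rewrite ltr_pdivrMr// ler_pdivlMr ?ltr0n// => h1 h2.
have h3 : (Num.bound (`|c| / a))%:R <= (Num.bound (`|c| / a)).*2.+1%:R :> R.
  by rewrite ler_nat -addnn ltnW// ltnS leq_addr.
have := ler_wpM2l (ltW a0) h3; have := ler_norm c; lra.
Qed.

(** The factors [A] and [B], here integrals of the spin model or constants, do not depend on [n],
    and the grid volume multiplies both sides alike. *)
Lemma approximates_le p q P Q A B : approximates p P -> approximates q Q ->
  (forall n, ~~ odd n -> p n * A <= q n * B) -> P * A <= Q * B.
Proof.
move=> [c [c0 hc]] [d [d0 hd]] h; rewrite -subr_le0.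
apply: (@le0_even_archimedean _ (c * `|A| + d * `|B|)) => n no.
have vp := grid_vol_gt0 n; have := ler_wpM2l (ltW vp) (h n no) => h1.
have h2 : (P - grid_vol n * p n) * A <= c / n.+1%:R * `|A|.
  by apply: (le_trans (ler_norm _)); rewrite normrM ler_wpM2r.
have h3 : - ((Q - grid_vol n * q n) * B) <= d / n.+1%:R * `|B|.
  by apply: (le_trans (ler_norm _)); rewrite normrN normrM ler_wpM2r.
move: h1 h2 h3; set e := n.+1%:R^-1; set g := grid_vol n.
set a := `|A|; set b := `|B|; move: (p n) (q n) => pn qn; lra.
Qed.

(** Every clock weight is at least [expR (- E)], so the Riemann sums are bounded below by [d],
    uniformly in [n]. *)
Lemma XY_Z_gt0 : 0 < XY_Z.
Proof.
have [c [c0 hc]] := clock_Z_approximates.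
pose E := pairsum (fun x y : T => `|J x y| + `|K x y|).
pose d : R := (2 * pi) ^+ #|T| * expR (- E).
have d0 : 0 < d by rewrite mulr_gt0 ?expR_gt0// exprn_gt0// mulr_gt0// pi_gt0.
apply: (lt_le_trans d0); rewrite -subr_le0; apply: (@le0_even_archimedean _ c) => n _.
have := hc n; suff : d <= grid_vol n * clock_Z n J K by rewrite ler_norml; set e := c / _; lra.
have n0 : n.+1%:R ^+ #|T| != 0 :> R by rewrite expf_neq0// pnatr_eq0.
rewrite (_ : d = grid_vol n * (n.+1%:R ^+ #|T| * expR (- E))); last first.
  by rewrite mulrA divfK.
rewrite ler_wpM2l ?(ltW (grid_vol_gt0 n))//.
rewrite (_ : _ * _ = \sum_(g : {ffun T -> 'I_n.+1}) expR (- E)); last first.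
  by rewrite sumr_const card_ffun card_ord -[RHS]mulr_natl natrX.
apply: ler_sum => g _; rewrite ler_expR /E /clock_energy /pairsum -sumrN.
apply: ler_sum => x _; rewrite -sumrN; apply: ler_sum => y _.
set u := cos _; set w := cos _.
have h (j z : R) : `|z| <= 1 -> - `|j| <= j * z.
  by move=> z1; rewrite lerNl; apply: (le_trans (ler_norm _)); rewrite normrN normrM ler_piMr.
have := h (J x y) u (cos_max _); have := h (K x y) w (cos_max _); lra.
Qed.

Lemma XY_cos_le m x y : XY_cos m x y <= XY_Z.
Proof.
rewrite -[leLHS]mulr1 -[leRHS]mulr1.
apply: (approximates_le _ _ _ _ _ _ (clock_cos_approximates m x y) clock_Z_approximates) => n _.
rewrite !mulr1; apply: ler_sum => g _.
by rewrite ler_piMl ?expR_ge0// cos_le1.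
Qed.

End XY_limit.

(** * Normalization and the limit of fine grids *)

Theorem theoremC8 (R : realType) (T : finType) (N : nat) (hN : (2 <= N)%N)
  (J' K' J K : T -> T -> R)
  (sJ' : forall x y, J' x y = J' y x) (sK' : forall x y, K' x y = K' y x)
  (sJ : forall x y, J x y = J y x) (sK : forall x y, K x y = K y x)
  (hJ : forall x y : T, x != y ->
     (if `|K' x y| <= `|J' x y| then `|J' x y|
      else 4^-1 * `|K' x y| * (1 + `|J' x y| / `|K' x y|) ^+ 2) <= J x y)
  (hK : forall x y : T, x != y -> 4^-1 * `|K' x y| <= K x y) :
  forall x y : T,
    `|Nexp J' K' (fun u : T * 'I_N -> R => sdot u x y)|
      <= XYexp J K (fun th => cos (th x - th y))
    /\
    (let gam := XYexp J K (fun th => cos (2 * (th x - th y))) in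
     let E2 := Nexp J' K' (fun u : T * 'I_N -> R => (sdot u x y) ^+ 2) in
     [/\ 0 <= E2,
         E2 <= N%:R^-1 + ((N%:R - 1) * (N%:R + 2))
                          / (N%:R * (2 * N%:R - (N%:R - 2) * gam)) * gam
       & N%:R^-1 + ((N%:R - 1) * (N%:R + 2))
                          / (N%:R * (2 * N%:R - (N%:R - 2) * gam)) * gam
         <= N%:R^-1 + (1 - N%:R^-1) * gam]).
Proof.
move=> x y.
have Z0 := XY_Z_gt0 J K; set Z := XY_Z J K in Z0.
set I1 := Nint J' K' (fun _ : T * 'I_N -> R => 1).
have I1E : fint setT (@Nweight R T N J' K') = I1.
  by congr fint; apply/funext => u; rewrite mul1r.
have I0 : 0 <= I1 by apply: Nint_ge0; [exact: observable_cst|].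
have cZ := clock_Z_approximates J K.
have c1 := clock_cos_approximates J K 1 x y.
have c2 := clock_cos_approximates J K 2 x y.
split.
  have -> : XYexp J K (fun th => cos (th x - th y)) = XY_cos J K 1 x y / Z.
    congr (fint _ _ / _); apply/funext => th; by rewrite mul1r.
  rewrite /Nexp I1E -/(Nint J' K' (fun u : T * 'I_N -> R => sdot u x y)).
  set s := Nint _ _ _.
  have h : Z * `|s| <= XY_cos J K 1 x y * I1.
    apply: (approximates_le _ _ _ _ _ _ cZ c1) => n no.
    exact: Nint_sdot_clock.
  have h0 : 0 <= XY_cos J K 1 x y.
    (* Nonnegativity passes to the limit as the comparison Z * 0 <= C * 1. *)
    rewrite -[leRHS]mulr1 -(mulr0 Z).
    apply: (approximates_le _ _ _ _ _ _ cZ c1) => n no.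
    by rewrite mulr0 mulr1; exact: (clock_cos1_ge0 no J' K' J K hJ hK).
  (* Positivity of the normalization is not established: if it vanished, the quotient would be 0 by
     convention and the bound would follow from [h0]. *)
  have [I00|In0] := eqVneq I1 0.
    by rewrite I00 invr0 mulr0 normr0 divr_ge0// ltW.
  have Ip : 0 < I1 by rewrite lt_def In0.
  rewrite normrM normfV (gtr0_norm Ip) ler_pdivrMr// mulrAC ler_pdivlMr//.
  by rewrite mulrC.
move=> gam E2.
have gamE : gam = XY_cos J K 2 x y / Z by [].
set q := Nint J' K' (fun u : T * 'I_N -> R => sdot u x y ^+ 2).
have E2E : E2 = q / I1 by rewrite /E2 /Nexp I1E.
have q0 : 0 <= q.
  by apply: Nint_ge0 => [|u]; [apply: observableX; exact: observable_sdot|exact: sqr_ge0].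
have g1 : gam <= 1 by rewrite gamE ler_pdivrMr// mul1r; exact: XY_cos_le.
have g0 : 0 <= gam.
  rewrite gamE divr_ge0 ?(ltW Z0)// -[leRHS]mulr1 -(mulr0 Z).
  apply: (approximates_le _ _ _ _ _ _ cZ c2) => n no.
  by rewrite mulr0 mulr1; exact: (clock_cos2_ge0 no J' K' J K hJ hK).
have N2 : 2 <= N%:R :> R by rewrite ler_nat.
have Np : 0 < N%:R :> R by lra.
set den := 2 * N%:R - (N%:R - 2) * gam.
(* The minimum of [den] over [gam <= 1] is attained at 1; this also gives the last inequality of the
   theorem. *)
have dge : N%:R + 2 <= den by rewrite /den; have := ler_wpM2l (_ : 0 <= N%:R - 2) g1; nra.
have dp : 0 < den by lra.
have key : E2 * den <= 2 + N%:R * gam.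
  (* The terms are regrouped so that each side carries a single clock quantity, as [approximates_le]
     requires. *)
  have h : Z * (2 * N%:R * q - 2 * I1) <= XY_cos J K 2 x y * ((N%:R - 2) * q + N%:R * I1).
    apply: (approximates_le _ _ _ _ _ _ cZ c2) => n no.
    by have := Nint_sdot2_clock hN no J' K' J K hJ hK x y; rewrite -/q -/I1; lra.
  have [I00|In0] := eqVneq I1 0.
    by rewrite E2E I00 invr0 mulr0 mul0r addr_ge0// mulr_ge0// ltW.
  have Ip : 0 < I1 by rewrite lt_def In0.
  have qE : q = E2 * I1 by rewrite E2E divfK.
  have CE : XY_cos J K 2 x y = gam * Z by rewrite gamE divfK// gt_eqF.
  have ZI : 0 < Z * I1 by rewrite mulr_gt0.
  rewrite -(ler_pM2l ZI) /den; move: h; rewrite qE CE; lra.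
have rhsE : N%:R^-1 + (N%:R - 1) * (N%:R + 2) / (N%:R * den) * gam = (2 + N%:R * gam) / den.
  by rewrite /den; field; rewrite ?gt_eqF.
split.
- by rewrite E2E divr_ge0.
- by rewrite rhsE ler_pdivlMr.
(* After cancelling (N - 1) / N this is (N + 2) / den <= 1, that is [dge]. *)
rewrite lerD2l; apply: ler_wpM2r => //.
rewrite (_ : 1 - N%:R^-1 = (N%:R - 1) / N%:R); last by field; rewrite gt_eqF.
rewrite ler_pdivlMr// (_ : _ / _ * N%:R = (N%:R - 1) * ((N%:R + 2) / den)); last first.
  by field; rewrite ?gt_eqF.
rewrite ler_piMr ?subr_ge0//; first by lra.
by rewrite ler_pdivrMr// mul1r.
Qed.
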